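(* Let $G$ be a plane weighted graph with $2n$ vertices. Let $k$ be an integer with $2\le k\le n$, and let vertices $a_1,b_1,a_2,b_2,\ldots,a_k,b_k$ appear in this cyclic order on a face of $G$. Let $A=\{a_1,\ldots,a_k\}$ and $B=\{b_1,\ldots,b_k\}$. Then for every $j\in\{1,2,\ldots,k\}$, $$\sum_{Y\subseteq B,\ |Y|\text{ odd}} M(G-a_j-Y)\,M\big(G-(A\setminus\{a_j\})-(B\setminus Y)\big)=\sum_{W\subseteq B,\ |W|\text{ even}} M(G-W)\,M\big(G-A-(B\setminus W)\big),$$ where the left sum ranges over all subsets $Y$ of $B$ of odd cardinality and the right sum over all subsets $W$ of $B$ of even cardinality (including $W=\emptyset$).
   Context: For a weighted graph $H$ (each edge carries a weight), a perfect matching is a set of pairwise disjoint edges covering every vertex; its weight is the product of the weights of its edges, and $M(H)$ denotes the sum of the weights of all perfect matchings of $H$ (the empty graph has $M=1$). For a set $S$ of vertices, $H-S$ (also written $H-s_1-\cdots-s_r$) is the graph obtained by deleting the vertices of $S$ and all incident edges. A plane graph is a graph embedded in the plane without crossings; the vertices appearing ''in cyclic order on a face'' means they occur in that cyclic order along the boundary of that face. *)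

(* Defs.v *)
From HB Require Import structures.
From mathcomp Require Import all_boot all_order all_algebra.
From mathcomp Require Import all_classical all_reals all_analysis.

Set Implicit Arguments.
Unset Strict Implicit.
Unset Printing Implicit Defensive.

Import Order.TTheory GRing.Theory Num.Theory.
Import numFieldNormedType.Exports.

Local Open Scope ring_scope.

(* Parallel edges are allowed, loops are not.  Edges are undirected: source and
   target only name the two ends, and nothing below depends on their order
   except the direction in which the arc of an edge is parametrized. *)
Record wgraph (K : Type) := WGraph {
  vert : finType;
  edge : finType;
  source : edge -> vert;
  target : edge -> vert;
  weight : edge -> K;
  loopless : forall e, source e != target e }.

Definition ends (K : Type) (G : wgraph K) (e : edge G) : {set vert G} :=
  [set source e; target e]%SET.

Definition perfect_matching (K : Type) (G : wgraph K) (N : {set edge G}) :=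
  [forall e in N, forall f in N, (e != f) ==> [disjoint ends e & ends f]]
  && [forall v, exists e in N, v \in ends e].

Definition M (K : comNzRingType) (G : wgraph K) : K :=
  \sum_(N : {set edge G} | perfect_matching N) \prod_(e in N) weight e.

Section Deletion.
Variables (K : Type) (G : wgraph K) (S : {set vert G}).

Definition del_vert : finType := {v : vert G | v \notin S}.
Definition del_edge : finType :=
  {e : edge G | (source e \notin S) && (target e \notin S)}.

Definition del_source (e : del_edge) : del_vert :=
  exist _ (source (val e)) (proj1 (andP (valP e))).
Definition del_target (e : del_edge) : del_vert :=
  exist _ (target (val e)) (proj2 (andP (valP e))).

Lemma del_loopless e : del_source e != del_target e.
Proof. exact: (loopless (val e)). Qed.

Definition del : wgraph K :=
  WGraph (fun e : del_edge => weight (val e)) del_loopless.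

End Deletion.

Local Open Scope classical_set_scope.

Record plane_embedding (R : realType) (K : Type) (G : wgraph K) :=
  PlaneEmbedding {
  pt : vert G -> R * R;
  curve : edge G -> R -> R * R;
  pt_inj : injective pt;
  curve_continuous : forall e, {within `[0, 1], continuous (curve e)};
  curve_inj : forall e (s t : R), 0 <= s <= 1 -> 0 <= t <= 1 ->
    curve e s = curve e t -> s = t;
  curve0 : forall e, curve e 0 = pt (source e);
  curve1 : forall e, curve e 1 = pt (target e);
  curve_vert : forall e (t : R) v, 0 < t < 1 -> curve e t <> pt v;
  curve_disj : forall e f (s t : R), e != f -> 0 < s < 1 -> 0 < t < 1 ->
    curve e s <> curve f t }.

Section Faces.
Variables (R : realType) (K : Type) (G : wgraph K) (D : plane_embedding R G).

Definition drawing : set (R * R) :=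
  range (pt D) `|` \bigcup_e (curve D e @` `[0, 1]).

Definition face (F : set (R * R)) : Prop :=
  exists2 x, (~` drawing) x & F = connected_component (~` drawing) x.

Definition unit_disc : set (R * R) := [set p | p.1 ^+ 2 + p.2 ^+ 2 <= 1].

Definition circle_pt (t : R) : R * R := (cos t, sin t).

(* The boundary of a face need not be a simple closed curve (it may pass
   several times through a cut vertex or both sides of a bridge, and the face
   may be unbounded), so the order of vertices along it is read from inside the
   face: there is a topological closed disc, contained in F except that its
   boundary circle touches the graph at the listed vertices, and the circle
   meets these vertices in the listed cyclic order.  When the boundary of F is
   a single closed walk, such a disc is the image of the polygon inscribed in a
   disc whose boundary traces that walk.
   Since phi may reverse orientation, the order may be clockwise or
   counterclockwise. *)
Definition cyclic_on_face (F : set (R * R)) (s : seq (vert G)) : Prop :=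
  exists (theta : 'I_(size s) -> R) (phi : R * R -> R * R),
  [/\ (forall i j : 'I_(size s), (i < j)%N ->
         theta i < theta j < theta i + 2 * pi),
      {within unit_disc, continuous phi},
      (forall p q, unit_disc p -> unit_disc q -> phi p = phi q -> p = q),
      (forall i, phi (circle_pt (theta i)) = pt D (tnth (in_tuple s) i)) &
      (forall p, unit_disc p ->
         (exists i, p = circle_pt (theta i)) \/ F (phi p))].

End Faces.

(* a_1, b_1, a_2, b_2, ..., a_k, b_k *)
Definition interleave (T : Type) (k : nat) (a b : 'I_k -> T) : seq T :=
  flatten [seq [:: a i; b i] | i <- enum 'I_k].

(* Main.v *)
Require Import Defs.
From HB Require Import structures.
From mathcomp Require Import all_boot all_order all_algebra.
From mathcomp Require Import all_classical all_reals all_analysis.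
From mathcomp Require Import zify ring lra.

Set Implicit Arguments.
Unset Strict Implicit.
Unset Printing Implicit Defensive.

Import Order.TTheory GRing.Theory Num.Theory.
Import numFieldNormedType.Exports.

Local Open Scope ring_scope.

(* Superpose a matching of the first factor with one of the second.  Every
   vertex of A :|: B is missed by exactly one of them, every other vertex by
   none, so each component of the superposition contains zero or two vertices
   of A :|: B.  Exchanging the two matchings on the component of a_j moves a_j
   from one deleted set to the other; it maps the terms of the left sum to those
   of the right sum and is an involution, provided the other end of the path
   starting at a_j is in B.  If it were some a_i, an odd number of the marked
   vertices would lie strictly between a_j and a_i on the face, so some path
   would join a vertex between them to a vertex outside: two disjoint connected
   parts of the drawing would have interleaved ends on a disc of the face.

   That this is impossible is a mod 2 intersection argument.  Close up both
   parts alpha, beta by chords of the disc.  The difference of a point of the first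
   closed curve and a point of the second is a map from a torus to the plane
   vanishing only where the chords cross, so it has even winding number around
   the boundary of the square "chord times chord".  On the other hand, inside
   the embedded disc this loop is homotopic, avoiding zero, to an odd loop,
   whose winding number is odd.  Winding numbers mod 2 are computed on fine
   discretizations by counting crossings of a half-line, so that only uniform
   continuity and positive distances between compact sets are needed. *)

(** * Winding parity of discrete loops *)

Section CrossingParity.
Variable R : realType.
Implicit Types (p q r : R * R) (e : R).

(** A half-plane together with half of its boundary line. For p nonzero it contains exactly one of p
    and - p, so points on the axis need no general position. *)
Definition upper p := (0 < p.2) || ((p.2 == 0) && (0 < p.1)).

(* The parity of crossings of the half-line y = 0, x > 0 by the segment from p
   to q; only meaningful when |p - q| is smaller than |p| and |q|. *)
Definition crossing p q := (upper p != upper q) && (0 < p.1).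

Lemma prod_norm_lt p e : (`|p| < e) = (`|p.1| < e) && (`|p.2| < e).
Proof. by rewrite prod_normE gt_max. Qed.

Lemma prod_le_norm p e : (e <= `|p|) = (e <= `|p.1|) || (e <= `|p.2|).
Proof. by rewrite prod_normE le_max. Qed.

(** A short step that changes [upper] meets the horizontal axis, so both second coordinates are
    below e. In the max norm the first coordinates must then reach e, and a step shorter than e
    cannot change their sign. *)
Lemma upper_diff p q e : 0 < e -> e <= `|p| -> e <= `|q| -> `|p - q| < e ->
  upper p != upper q ->
  [/\ e <= `|p.1|, e <= `|q.1| & (0 < p.1) = (0 < q.1)].
Proof.
rewrite !prod_le_norm prod_norm_lt /= /upper => e0 hp hq /andP[h1 h2] hu.
have {}h1 : -e < p.1 - q.1 < e by rewrite -ltr_norml.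
have {}h2 : -e < p.2 - q.2 < e by rewrite -ltr_norml.
move: hp hq; rewrite !ler_normr => hp hq.
have hu2 : (p.2 <= 0 /\ 0 <= q.2) \/ (0 <= p.2 /\ q.2 <= 0).
  by move: hu; case: (ltrgt0P p.2); case: (ltrgt0P q.2) => /=; lra.
have hp1 : e <= p.1 \/ e <= - p.1 by move: hp; lra.
have hq1 : e <= q.1 \/ e <= - q.1 by move: hq; lra.
split; [lra | lra |].
by apply/idP/idP; lra.
Qed.

Lemma crossingC p q e : 0 < e -> e <= `|p| -> e <= `|q| -> `|p - q| < e ->
  crossing p q = crossing q p.
Proof.
move=> e0 hp hq hpq; rewrite /crossing (eq_sym (upper q)).
by case: (boolP (_ != _)) => //= /(upper_diff e0 hp hq hpq)[_ _ ->].
Qed.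

(** Around a triangle [upper] changes on zero or two sides, and by [upper_diff] the first
    coordinates at changing sides agree in sign. *)
Lemma crossing_triangle p q r e : 0 < e ->
  e <= `|p| -> e <= `|q| -> e <= `|r| ->
  `|p - q| < e -> `|q - r| < e -> `|p - r| < e ->
  crossing p q (+) crossing q r = crossing p r.
Proof.
move=> e0 hp hq hr hpq hqr hpr.
have h1 := @upper_diff _ _ _ e0 hp hq hpq.
have h2 := @upper_diff _ _ _ e0 hq hr hqr.
have h3 := @upper_diff _ _ _ e0 hp hr hpr.
rewrite /crossing; move: h1 h2 h3.
case: (upper p) (upper q) (upper r) => -[] [] //= h1 h2 h3.
- by have [_ _ ->] := h2 isT; have [_ _ ->] := h3 isT.
- by have [_ _ ->] := h1 isT; rewrite addbb.
- by rewrite addbF.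
- by rewrite addbF.
- by have [_ _ ->] := h1 isT; rewrite addbb.
- by have [_ _ ->] := h2 isT; have [_ _ ->] := h3 isT.
Qed.

Lemma upperN p : p != 0 -> upper (- p) = ~~ upper p.
Proof.
case: p => x y; rewrite /upper /= -[_ == 0]/((x == 0) && (y == 0)) => h.
by move: h; case: (ltrgt0P x); case: (ltrgt0P y) => /= *; apply/idP/idP; lra.
Qed.

(** A change of [upper] meets either the positive half of the axis or the negative one; in the
    second case the antipodal segment meets the positive half. *)
Lemma crossingN p q e : 0 < e -> e <= `|p| -> e <= `|q| -> `|p - q| < e ->
  crossing p q (+) crossing (- p) (- q) = (upper p != upper q).
Proof.
move=> e0 hp hq hpq.
have n0 x : e <= `|x| -> x != 0 :> R * R.
  by move=> hx; rewrite -normr_gt0 (lt_le_trans e0).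
have := @upper_diff _ _ _ e0 hp hq hpq.
rewrite /crossing !upperN ?n0 // /=.
case: (upper p) (upper q) => -[] //= /(_ isT)[h1 _ _];
  have : p.1 != 0 by rewrite -normr_gt0 (lt_le_trans e0).
all: by rewrite oppr_gt0; case: ltrgt0P.
Qed.

(** For a closed chain this is the winding number mod 2 around the origin. Open chains are allowed,
    so that loops can be assembled from their sides. *)
Definition turns m (f : nat -> R * R) : bool :=
  \big[addb/false]_(i < m) crossing (f i) (f i.+1).

Lemma turns_upper m (f : nat -> R * R) :
  \big[addb/false]_(i < m) (upper (f i) != upper (f i.+1))
  = (upper (f 0%N) != upper (f m)).
Proof.
elim: m => [|m IH]; first by rewrite big_ord0 eqxx.
by rewrite big_ord_recr /= IH; case: (upper (f 0%N)) (upper (f m)) (upper (f m.+1)) => [] [] [].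
Qed.

(** Reversing a chain does not alter its crossings, so each step paired with its antipode
    contributes a change of [upper], and these telescope. *)
Lemma turns_antipodal e m (f g : nat -> R * R) : 0 < e ->
  (forall i, (i <= m)%N -> g i = - f (m - i)%N) ->
  (forall i, (i <= m)%N -> e <= `|f i|) ->
  (forall i, (i < m)%N -> `|f i - f i.+1| < e) ->
  turns m f (+) turns m g = (upper (f 0%N) != upper (f m)).
Proof.
move=> e0 gf hf hff; rewrite -turns_upper /turns.
rewrite [X in _ (+) X](reindex_inj rev_ord_inj) /= -big_split /=.
apply: eq_bigr => i _; have im := ltn_ord i.
rewrite subnSK // !gf ?leq_subr // (subKn im) (subKn (ltnW im)).
rewrite [X in _ (+) X](@crossingC _ _ e) ?normrN ?hf ?(ltnW im) //.
  by rewrite (@crossingN _ _ e) ?hf ?hff ?(ltnW im).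
by rewrite opprK addrC hff.
Qed.

(** Each cell of the strip is cut by the diagonal from [f i] to [g i.+1] into two triangles, to
    which [crossing_triangle] applies. *)
Lemma turns_strip e m (f g : nat -> R * R) : 0 < e ->
  (forall i, (i <= m)%N -> e <= `|f i|) ->
  (forall i, (i <= m)%N -> e <= `|g i|) ->
  (forall i, (i < m)%N -> `|f i - f i.+1| < e) ->
  (forall i, (i < m)%N -> `|g i - g i.+1| < e) ->
  (forall i, (i <= m)%N -> `|f i - g i| < e) ->
  (forall i, (i < m)%N -> `|f i - g i.+1| < e) ->
  turns m f (+) turns m g =
  crossing (f 0%N) (g 0%N) (+) crossing (f m) (g m).
Proof.
move=> e0 hf hg hff hgg hfg hfg'.
suff h i : (i <= m)%N -> turns i f (+) turns i g =
    crossing (f 0%N) (g 0%N) (+) crossing (f i) (g i) by exact: h.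
elim: i => [|i IH] im; first by rewrite /turns !big_ord0 !addbb.
have im' := ltnW im.
rewrite /turns !big_ord_recr /= addbACA -!/(turns _ _) IH //.
have h1 := @crossing_triangle (f i) (f i.+1) (g i.+1) e e0
  (hf _ im') (hf _ im) (hg _ im) (hff _ im) (hfg _ im) (hfg' _ im).
have h2 := @crossing_triangle (f i) (g i) (g i.+1) e e0
  (hf _ im') (hg _ im') (hg _ im) (hfg _ im') (hgg _ im) (hfg' _ im).
move: h1; rewrite -h2 {IH h2}.
move: (crossing (f i) (f i.+1)) (crossing (f i) (g i)) (crossing (g i) (g i.+1)).
by move: (crossing (f 0%N) _) (crossing (f i.+1) _) => [] [] [] [] [].
Qed.

(* Mod 2, the crossings along the boundary of each cell cancel, and interior
   edges are counted twice. *)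
Lemma turns_grid e m n (f : nat -> nat -> R * R) : 0 < e ->
  (forall i j, (i <= m)%N -> (j <= n)%N -> e <= `|f i j|) ->
  (forall i j i' j', (i <= i' <= i.+1)%N -> (j <= j' <= j.+1)%N ->
    (i' <= m)%N -> (j' <= n)%N -> `|f i j - f i' j'| < e) ->
  turns m (f^~ 0%N) (+) turns m (f^~ n)
  = turns n (f 0%N) (+) turns n (f m).
Proof.
move=> e0 hf hff.
suff h j : (j <= n)%N -> turns m (f^~ 0%N) (+) turns m (f^~ j)
    = turns j (f 0%N) (+) turns j (f m) by exact: h.
elim: j => [|j IH] jn; first by rewrite /turns !big_ord0 !addbb.
have jn' := ltnW jn.
have h : turns m (f^~ j) (+) turns m (f^~ j.+1) =
   crossing (f 0%N j) (f 0%N j.+1) (+) crossing (f m j) (f m j.+1).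
  by apply: (turns_strip e0) => i im; first [apply: hf; lia | apply: hff; lia].
rewrite {3 4}/turns !big_ord_recr /= addbACA -/(turns j (f 0%N)).
by rewrite -/(turns j (f m)) -IH // -h addbA addbK.
Qed.

End CrossingParity.

(** * Two chains with interleaved ends on an embedded disc *)

Section CrossingChains.
Variable R : realType.
Implicit Types (s t r e : R) (z : R * R).

(** The two diagonals of this square, along the coordinate axes, parametrize the two crossing
    chords. *)
Definition diamond : set (R * R) := [set z | `|z.1| + `|z.2| <= 1].

(* The chord points psi (s, 0) and psi (0, t) are deformed into the antipodal
   pair psi (z / 2), psi (- z / 2) with z = (s, - t), keeping the difference of
   the two arguments equal to z. *)
Definition deform (psi : R * R -> R * R) s t r : R * R :=
  psi (s * (1 - r / 2), - (r * t / 2)) - psi (- (r * s / 2), t * (1 - r / 2)).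

Lemma deform0 psi s t : deform psi s t 0 = psi (s, 0) - psi (0, t).
Proof. by rewrite /deform !mul0r oppr0 addr0 !mulr1. Qed.

Lemma deform1N psi s t : deform psi (- s) (- t) 1 = - deform psi s t 1.
Proof.
rewrite /deform opprB; congr (psi (_, _) - psi (_, _)); lra.
Qed.

(** Both points have l1 norm equal to a convex combination of |s| and |t|, with weights 1 - r/2 and
    r/2. *)
Lemma deform_diamond s t r : `|s| <= 1 -> `|t| <= 1 -> 0 <= r <= 1 ->
  diamond (s * (1 - r / 2), - (r * t / 2)) /\
  diamond (- (r * s / 2), t * (1 - r / 2)).
Proof.
move=> s1 t1 /andP[r0 r1].
have h : `|1 - r / 2| = 1 - r / 2 by rewrite ger0_norm //; lra.
rewrite /diamond /= !normrN !normrM h !(ger0_norm r0).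
by rewrite (@ger0_norm _ (2^-1)) ?invr_ge0 //; split; nra.
Qed.

Lemma frac_near (N i i' : nat) : (0 < N)%N -> (i <= i' <= i.+1)%N ->
  `|i%:R / N%:R - i'%:R / N%:R : R| <= N%:R^-1.
Proof.
move=> N0 h; have NR : 0 <= N%:R^-1 :> R by rewrite invr_ge0.
have [->|->] : i' = i \/ i' = i.+1 by lia.
  by rewrite subrr normr0.
rewrite -mulrBl -[i.+1]addn1 natrD opprD addrA subrr add0r mulN1r normrN.
by rewrite ger0_norm.
Qed.

Section Chains.
Variables (psi : R * R -> R * R) (e : R) (N : nat).
Hypotheses (e0 : 0 < e) (N0 : (0 < N)%N).
Hypothesis psi_fine : forall z z', diamond z -> diamond z' ->
  `|z - z'| <= 2 / N%:R -> `|psi z - psi z'| < e / 2.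
Hypothesis psi_far : forall z z', diamond z -> diamond z' ->
  1 <= `|z - z'| -> e <= `|psi z - psi z'|.

Let NR : 0 < N%:R :> R. Proof. by rewrite ltr0n. Qed.

(** The two arguments of [psi] differ by (s, - t) whatever r is, so over the boundary of the square
    the deformation stays away from zero. *)
Lemma deform_far s t r : `|s| <= 1 -> `|t| <= 1 -> 0 <= r <= 1 ->
  (1 <= `|s|) || (1 <= `|t|) -> e <= `|deform psi s t r|.
Proof.
move=> s1 t1 r01 st; have [d1 d2] := deform_diamond s1 t1 r01.
apply: psi_far => //; rewrite prod_le_norm /=.
have -> : s * (1 - r / 2) - - (r * s / 2) = s by lra.
by have -> : - (r * t / 2) - t * (1 - r / 2) = - t; [lra | rewrite normrN].
Qed.

(** The arguments of [psi] are bilinear in the parameters: one mesh step in s or t and one in r each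
    move a coordinate by at most 1/N, whence the 2/N in [psi_fine]. *)
Lemma deform_near s t r s' t' r' : `|s| <= 1 -> `|t| <= 1 -> 0 <= r <= 1 ->
  `|s'| <= 1 -> `|t'| <= 1 -> 0 <= r' <= 1 ->
  `|s - s'| <= N%:R^-1 -> `|t - t'| <= N%:R^-1 -> `|r - r'| <= N%:R^-1 ->
  `|deform psi s t r - deform psi s' t' r'| < e.
Proof.
move=> s1 t1 r1 s1' t1' r1' ds dt dr.
have [h1 h2] := deform_diamond s1 t1 r1.
have [h1' h2'] := deform_diamond s1' t1' r1'.
have near1 x x' : `|x| <= 1 -> `|x'| <= 1 -> `|x - x'| <= N%:R^-1 ->
    `|x * (1 - r / 2) - x' * (1 - r' / 2)| <= 2 / N%:R /\
    `|r * x / 2 - r' * x' / 2| <= 2 / N%:R.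
  move=> x1 x1' dx.
  have -> : x * (1 - r / 2) - x' * (1 - r' / 2) =
     (x - x') * (1 - r / 2) - x' * (r - r') / 2 by lra.
  have -> : r * x / 2 - r' * x' / 2 = (x - x') * (r / 2) + x' * (r - r') / 2.
    by lra.
  have ha : `|x' * (r - r') / 2| <= N%:R^-1.
    rewrite !normrM (@ger0_norm _ (2^-1)) ?invr_ge0 //.
    have : `|x'| * `|r - r'| <= 1 * N%:R^-1 by apply: ler_pM.
    have : 0 <= `|x'| * `|r - r'| by apply: mulr_ge0.
    by lra.
  have hb c : 0 <= c <= 1 -> `|(x - x') * c| <= N%:R^-1.
    move=> /andP[c0 c1]; rewrite normrM (ger0_norm c0).
    by apply: (le_trans _ dx); rewrite ler_piMr.
  split.
    apply: (le_trans (ler_normB _ _)).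
    have /hb : 0 <= 1 - r / 2 <= 1 by lra.
    by lra.
  apply: (le_trans (ler_normD _ _)).
  have /hb : 0 <= r / 2 <= 1 by lra.
  by lra.
have [a1 a2] := near1 s s' s1 s1' ds.
have [b1 b2] := near1 t t' t1 t1' dt.
rewrite /deform opprD addrACA -opprD.
apply: (le_lt_trans (ler_normB _ _)).
rewrite [ltRHS](splitr e); apply: ltrD; apply: psi_fine => //.
  by rewrite prod_normE /= ge_max a1 -opprD normrN b2.
by rewrite prod_normE /= ge_max b1 -opprD normrN a2.
Qed.

(** Descends from 1 to -1 in 2N steps, symmetrically about i = N, so that reversing the index
    negates the value as [turns_antipodal] requires. *)
Definition mesh i : R := 1 - i%:R / N%:R.

Lemma mesh_norm i : (i <= 2 * N)%N -> `|mesh i| <= 1.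
Proof.
move=> iN; rewrite /mesh ler_norml.
have : i%:R / N%:R <= 2 :> R by rewrite ler_pdivrMr // -natrM ler_nat.
have : 0 <= i%:R / N%:R :> R by rewrite divr_ge0.
by lra.
Qed.

Lemma mesh_near i i' : (i <= i' <= i.+1)%N -> `|mesh i - mesh i'| <= N%:R^-1.
Proof.
move=> /(frac_near N0); rewrite -normrN; congr (`|_| <= _); rewrite /mesh; lra.
Qed.

Lemma mesh0 : mesh 0 = 1. Proof. by rewrite /mesh mul0r subr0. Qed.

Lemma meshN i : (i <= 2 * N)%N -> mesh (2 * N - i) = - mesh i.
Proof.
by move=> iN; rewrite /mesh natrB // natrM; field; rewrite gt_eqF.
Qed.

Lemma mesh2N : mesh (2 * N) = -1.
Proof. by rewrite -[(2 * N)%N]subn0 meshN // mesh0. Qed.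

Lemma frac01 k : (k <= N)%N -> 0 <= (k%:R / N%:R : R) <= 1.
Proof. by move=> kN; rewrite divr_ge0 //= ler_pdivrMr // mul1r ler_nat. Qed.

Let n1 : `|1 : R| <= 1. Proof. by rewrite normr1. Qed.

(** [turns_grid] on one side of the square times the deformation parameter. The right-hand side
    holds the paths of the two corners, which the sides of [deform_side2] share. *)
Lemma deform_side1 c : `|c| = 1 ->
  turns (2 * N) (fun i => deform psi (mesh i) c 0) (+)
  turns (2 * N) (fun i => deform psi (mesh i) c 1) =
  turns N (fun k => deform psi 1 c (k%:R / N%:R)) (+)
  turns N (fun k => deform psi (-1) c (k%:R / N%:R)).
Proof.
move=> c1; have c1' : `|c| <= 1 by rewrite c1.
have := @turns_grid _ e (2 * N) N
  (fun i k => deform psi (mesh i) c (k%:R / N%:R)) e0.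
rewrite mul0r mesh0 divff ?gt_eqF // mesh2N.
apply=> [i k iN kN|i k i' k' hi hk iN kN].
  by apply: deform_far; rewrite ?mesh_norm ?frac01 ?c1 ?lexx ?orbT.
apply: deform_near; rewrite ?mesh_norm ?frac01 ?mesh_near ?frac_near //; try lia.
by rewrite subrr normr0 invr_ge0 ltW.
Qed.

Lemma deform_side2 c : `|c| = 1 ->
  turns (2 * N) (fun i => deform psi c (mesh i) 0) (+)
  turns (2 * N) (fun i => deform psi c (mesh i) 1) =
  turns N (fun k => deform psi c 1 (k%:R / N%:R)) (+)
  turns N (fun k => deform psi c (-1) (k%:R / N%:R)).
Proof.
move=> c1; have c1' : `|c| <= 1 by rewrite c1.
have := @turns_grid _ e (2 * N) N
  (fun i k => deform psi c (mesh i) (k%:R / N%:R)) e0.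
rewrite mul0r mesh0 divff ?gt_eqF // mesh2N.
apply=> [i k iN kN|i k i' k' hi hk iN kN].
  by apply: deform_far; rewrite ?mesh_norm ?frac01 ?c1 ?lexx ?orbT.
apply: deform_near; rewrite ?mesh_norm ?frac01 ?mesh_near ?frac_near //; try lia.
by rewrite subrr normr0 invr_ge0 ltW.
Qed.

(** At r = 1 the map on the square is odd, so its boundary loop has odd winding number. Each pair of
    opposite sides reduces by [turns_antipodal] to a comparison of [upper] at two corners. *)
Lemma deform_square :
  turns (2 * N) (fun i => deform psi (mesh i) 1 1) (+)
  turns (2 * N) (fun i => deform psi (mesh i) (-1) 1) !=
  turns (2 * N) (fun i => deform psi 1 (mesh i) 1) (+)
  turns (2 * N) (fun i => deform psi (-1) (mesh i) 1).
Proof.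
rewrite (@turns_antipodal _ e (2 * N)) //; first last.
- move=> i iN; apply: deform_near; rewrite ?mesh_norm ?mesh_near //; try lia.
  + by rewrite ler01 lexx.
  + by rewrite ler01 lexx.
  + by rewrite subrr normr0 invr_ge0 ltW.
  + by rewrite subrr normr0 invr_ge0 ltW.
- move=> i iN; apply: deform_far; rewrite ?mesh_norm ?normr1 ?lexx ?orbT //.
  by rewrite ler01.
- by move=> i iN; rewrite meshN // -deform1N opprK.
rewrite (@turns_antipodal _ e (2 * N)) //; first last.
- move=> i iN; apply: deform_near; rewrite ?mesh_norm ?mesh_near //; try lia.
  + by rewrite ler01 lexx.
  + by rewrite ler01 lexx.
  + by rewrite subrr normr0 invr_ge0 ltW.
  + by rewrite subrr normr0 invr_ge0 ltW.
- move=> i iN; apply: deform_far; rewrite ?mesh_norm ?normr1 ?lexx ?orbT //.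
  by rewrite ler01.
- by move=> i iN; rewrite meshN // -deform1N opprK.
(* Both comparisons involve the corner (1, 1); the other two corners, (-1, 1) and (1, -1), are
   antipodal, so [upper] differs there. *)
have h : e <= `|deform psi 1 (-1) 1|.
  by apply: deform_far; rewrite ?normrN ?normr1 ?lexx // ler01.
have := deform1N psi 1 (-1); rewrite opprK mesh0 mesh2N => ->.
rewrite upperN ?(lt_le_trans e0 h) -?normr_gt0 ?(lt_le_trans e0 h) //.
by case: (upper _) (upper _) => [] [].
Qed.

Variables (alpha beta : nat -> R * R) (p q : nat).
Hypotheses (alpha0 : alpha 0 = psi (1, 0)) (alphap : alpha p = psi (-1, 0)).
Hypotheses (beta0 : beta 0 = psi (0, 1)) (betaq : beta q = psi (0, -1)).
Hypothesis alpha_near :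
  forall i, (i < p)%N -> `|alpha i - alpha i.+1| < e / 2.
Hypothesis beta_near : forall i, (i < q)%N -> `|beta i - beta i.+1| < e / 2.
Hypothesis alpha_beta :
  forall i j, (i <= p)%N -> (j <= q)%N -> e <= `|alpha i - beta j|.
Hypothesis alpha_axis : forall i t, (i <= p)%N -> `|t| <= 1 ->
  e <= `|alpha i - psi (0, t)|.
Hypothesis beta_axis : forall j s, (j <= q)%N -> `|s| <= 1 ->
  e <= `|psi (s, 0) - beta j|.

(** [turns_grid] on a product of two chains. Steps below e/2 are asked of each so that moving along
    both at once stays below e. *)
Lemma turns_sub m n (f g : nat -> R * R) :
  (forall i j, (i <= m)%N -> (j <= n)%N -> e <= `|f i - g j|) ->
  (forall i, (i < m)%N -> `|f i - f i.+1| < e / 2) ->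
  (forall i, (i < n)%N -> `|g i - g i.+1| < e / 2) ->
  turns m (fun i => f i - g 0%N) (+) turns m (fun i => f i - g n) =
  turns n (fun j => f 0%N - g j) (+) turns n (fun j => f m - g j).
Proof.
move=> fg ff gg; apply: (@turns_grid _ e m n (fun i j => f i - g j)) => //.
have near h l i i' : (forall i, (i < l)%N -> `|h i - h i.+1 : R * R| < e / 2) ->
    (i <= i' <= i.+1)%N -> (i' <= l)%N -> `|h i - h i'| < e / 2.
  move=> hh ii' il; have [i'E|i'E] : i' = i \/ i' = i.+1 by lia.
    by rewrite i'E subrr normr0 divr_gt0.
  by rewrite i'E hh // -i'E.
move=> i j i' j' ii jj im jn; rewrite opprD addrACA -opprD.
apply: (le_lt_trans (ler_normB _ _)).
by rewrite [ltRHS](splitr e) ltrD ?(near f m) ?(near g n).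
Qed.

Let axis1 i := psi (mesh i, 0).
Let axis2 i := psi (0, mesh i).

Lemma diamond_axes t : `|t| <= 1 -> diamond (t, 0) /\ diamond (0, t).
Proof. by move=> t1; rewrite /diamond /= normr0 addr0 add0r. Qed.

Lemma axes_near i : (i < 2 * N)%N ->
  `|axis1 i - axis1 i.+1| < e / 2 /\ `|axis2 i - axis2 i.+1| < e / 2.
Proof.
move=> iN; have [a b] := diamond_axes (mesh_norm (ltnW iN)).
have [a' b'] := diamond_axes (mesh_norm iN).
have h : `|mesh i - mesh i.+1| <= 2 / N%:R.
  apply: (le_trans (mesh_near _)); first by lia.
  by have : 0 < N%:R^-1 :> R; [rewrite invr_gt0 | lra].
have h0 : 0 <= 2 / N%:R :> R by rewrite divr_ge0.
by split; apply: psi_fine => //; rewrite prod_normE /= ge_max subrr normr0 h0 h.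
Qed.

(* Summed over the rectangles alpha x beta, axis1 x beta and alpha x axis2, the
   turns along the boundary of axis1 x axis2 are even, which [deform_square]
   forbids. *)
Lemma crossing_chains : False.
Proof.
have h1 := turns_sub alpha_beta alpha_near beta_near.
have h2 : turns (2 * N) (fun i => axis1 i - beta 0%N) (+)
    turns (2 * N) (fun i => axis1 i - beta q) =
    turns q (fun j => axis1 0%N - beta j) (+)
    turns q (fun j => axis1 (2 * N)%N - beta j).
  apply: turns_sub => [i j iN jq|i iN|//]; first exact: beta_axis (mesh_norm iN).
  by case: (axes_near iN).
have h3 : turns p (fun i => alpha i - axis2 0%N) (+)
    turns p (fun i => alpha i - axis2 (2 * N)%N) =
    turns (2 * N) (fun j => alpha 0%N - axis2 j) (+)
    turns (2 * N) (fun j => alpha p - axis2 j).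
  apply: turns_sub => [i j iN jq|//|i iN]; first exact: alpha_axis (mesh_norm jq).
  by case: (axes_near iN).
have side1 c : turns (2 * N) (fun i => deform psi (mesh i) c 0) =
    turns (2 * N) (fun i => axis1 i - psi (0, c)).
  by congr turns; apply/funext => i; rewrite deform0.
have side2 c : turns (2 * N) (fun i => deform psi c (mesh i) 0) =
    turns (2 * N) (fun i => psi (c, 0) - axis2 i).
  by congr turns; apply/funext => i; rewrite deform0.
have s1 := deform_side1 (normr1 R); have s2 := deform_side2 (normr1 R).
have nN1 : `|-1 : R| = 1 by rewrite normrN normr1.
have s3 := deform_side1 nN1; have s4 := deform_side2 nN1.
have := deform_square.
move: h1 h2 h3 s1 s2 s3 s4; rewrite !side1 !side2 /axis1 /axis2 mesh0 mesh2N.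
rewrite alpha0 alphap beta0 betaq.
(* Each side at r = 1 becomes the same side at r = 0 plus its two corner paths; all four corner
   paths then occur on both sides of the inequality. *)
move=> h1 h2 h3 /(canRL (addKb _))-> /(canRL (addKb _))->.
move=> /(canRL (addKb _))-> /(canRL (addKb _))->.
rewrite addbACA [X in _ != X]addbACA h2 -h1 h3.

by rewrite [X in _ (+) X != _]addbACA eqxx.
Qed.

End Chains.
End CrossingChains.

(** * Four points on a circle *)

Section Chords.
Variable R : realType.
Implicit Types (t u v x y : R) (p q z : R * R).

(** Twice the signed area of the triangle p q r. *)
Definition orient p q r : R :=
  (q.1 - p.1) * (r.2 - p.2) - (q.2 - p.2) * (r.1 - p.1).

Definition sqnorm p : R := p.1 ^+ 2 + p.2 ^+ 2.

(** With u and v half the two arcs, the value is 4 sin u sin v sin (u + v), and u, v, u + v all lie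
    strictly between 0 and pi. *)
Lemma orient_circle t1 t2 t3 : t1 < t2 -> t2 < t3 -> t3 < t1 + 2 * pi ->
  0 < orient (circle_pt t1) (circle_pt t2) (circle_pt t3).
Proof.
move=> h12 h23 h31; pose u := (t2 - t1) / 2; pose v := (t3 - t2) / 2.
have su : 0 < sin u by apply: sin_gt0_pi; rewrite /u; lra.
have sv : 0 < sin v by apply: sin_gt0_pi; rewrite /v; lra.
have suv : 0 < sin (u + v) by apply: sin_gt0_pi; rewrite /u /v; lra.
suff -> : orient (circle_pt t1) (circle_pt t2) (circle_pt t3) =
    4 * (sin u * sin v * sin (u + v)) by rewrite !mulr_gt0.
have -> : orient (circle_pt t1) (circle_pt t2) (circle_pt t3) =
    sin (t2 - t1) + sin (t3 - t2) + sin (t1 - t3).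
  by rewrite /orient /circle_pt /= !sinB; ring.
have -> : t2 - t1 = u + u by rewrite /u; lra.
have -> : t3 - t2 = v + v by rewrite /v; lra.
have -> : t1 - t3 = - ((u + v) + (u + v)) by rewrite /u /v; lra.
rewrite sinN !sinD !cosD.
have hu : 1 - cos u ^+ 2 - sin u ^+ 2 = 0 by rewrite -(cos2Dsin2 u); ring.
have hv : 1 - cos v ^+ 2 - sin v ^+ 2 = 0 by rewrite -(cos2Dsin2 v); ring.
apply/eqP; rewrite -subr_eq0; apply/eqP.
transitivity (2 * sin u * cos u * (1 - cos v ^+ 2 - sin v ^+ 2) +
  2 * sin v * cos v * (1 - cos u ^+ 2 - sin u ^+ 2)); first by ring.
by rewrite hu hv !mulr0 addr0.
Qed.

Lemma sq_convex3 (a b c x y z : R) : 0 <= a -> 0 <= b -> 0 <= c -> a + b + c = 1 ->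
  (a * x + b * y + c * z) ^+ 2 <= a * x ^+ 2 + b * y ^+ 2 + c * z ^+ 2.
Proof.
move=> a0 b0 c0 abc; have -> : c = 1 - a - b by lra.
have h : 0 <= a * b * (x - y) ^+ 2 + a * (1 - a - b) * (x - z) ^+ 2
   + b * (1 - a - b) * (y - z) ^+ 2.
  by rewrite !addr_ge0 // mulr_ge0 ?sqr_ge0 // mulr_ge0 //; lra.
by rewrite -subr_ge0 (le_trans h) // le_eqVlt; apply/orP; left; apply/eqP; ring.
Qed.

(** The diagonals need not cross at their midpoints: from the point a p1 + c p3 one reaches p1 along
    c (p1 - p3) and p3 along - a (p1 - p3). *)
Definition stretch (a c x : R) : R := if 0 <= x then c * x else a * x.

Lemma stretch_sub (a c x x' : R) : 0 < a -> 0 < c -> a + c = 1 ->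
  Num.min a c * `|x - x'| <= `|stretch a c x - stretch a c x'| <= `|x - x'|.
Proof.
move=> a0 c0 ac; wlog le_x : x x' / x' <= x.
  by move=> h; case: (leP x' x) => [|/ltW] /h //; rewrite distrC [`|stretch _ _ _ - _|]distrC.
have m0 : Num.min a c <= a /\ Num.min a c <= c.
  by rewrite !ge_min !lexx orbT.
move: (Num.min a c) m0 => m [ma mc].
rewrite [`|x - x'|]ger0_norm ?subr_ge0 // /stretch.
by case: ifP => hx; case: ifP => hx'; rewrite ger0_norm; (try apply/andP; try split); nra.
Qed.

Lemma norm_coord p : `|p.1| <= `|p| /\ `|p.2| <= `|p|.
Proof. by rewrite prod_normE !le_max !lexx orbT. Qed.

(* Maps the diamond onto the quadrilateral p1 p2 p3 p4, and the origin to the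
   crossing point a p1 + c p3 = b p2 + d p4 of its diagonals. *)
Definition quad_map (p1 p2 p3 p4 : R * R) (a c b d : R) z : R * R :=
  (a * p1.1 + c * p3.1 + stretch a c z.1 * (p1.1 - p3.1)
     + stretch b d z.2 * (p2.1 - p4.1),
   a * p1.2 + c * p3.2 + stretch a c z.1 * (p1.2 - p3.2)
     + stretch b d z.2 * (p2.2 - p4.2)).

Section QuadMap.
Variables (p1 p2 p3 p4 : R * R) (a b c d : R).
Hypotheses (a0 : 0 < a) (b0 : 0 < b) (c0 : 0 < c) (d0 : 0 < d).
Hypotheses (ac : a + c = 1) (bd : b + d = 1).
Hypotheses (n1 : sqnorm p1 = 1) (n2 : sqnorm p2 = 1).
Hypotheses (n3 : sqnorm p3 = 1) (n4 : sqnorm p4 = 1).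
Hypothesis mid1 : a * p1.1 + c * p3.1 = b * p2.1 + d * p4.1.
Hypothesis mid2 : a * p1.2 + c * p3.2 = b * p2.2 + d * p4.2.
Let S := (p1.1 - p3.1) * (p2.2 - p4.2) - (p1.2 - p3.2) * (p2.1 - p4.1).
Hypothesis S0 : 0 < S.
Let L := quad_map p1 p2 p3 p4 a c b d.

Lemma quad_map_corners :
  [/\ L (1, 0) = p1, L (-1, 0) = p3, L (0, 1) = p2 & L (0, -1) = p4].
Proof.
have s0 (x y : R) : stretch x y 0 = 0 by rewrite /stretch lexx mulr0.
have s1 (x y : R) : stretch x y 1 = y by rewrite /stretch ler01 mulr1.
have sN1 (x y : R) : stretch x y (-1) = - x by rewrite /stretch ler0N1 mulrN1.
rewrite /L /quad_map /= s0 !s1 !sN1 s0 !mul0r !addr0.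
have cE : c = 1 - a by rewrite -ac; ring.
have dE : d = 1 - b by rewrite -bd; ring.
rewrite cE dE.
have h x y : a * x + (1 - a) * y + (1 - a) * (x - y) = x by ring.
have h' x y : a * x + (1 - a) * y + - a * (x - y) = y by ring.
rewrite !h !h'.
have -> : a * p1.1 + (1 - a) * p3.1 = b * p2.1 + (1 - b) * p4.1.
  by move: mid1; rewrite cE dE.
have -> : a * p1.2 + (1 - a) * p3.2 = b * p2.2 + (1 - b) * p4.2.
  by move: mid2; rewrite cE dE.
have k x y : b * x + (1 - b) * y + (1 - b) * (x - y) = x by ring.
have k' x y : b * x + (1 - b) * y + - b * (x - y) = y by ring.
by rewrite !k !k' -!surjective_pairing.
Qed.

Let x0 : R * R := (a * p1.1 + c * p3.1, a * p1.2 + c * p3.2).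

(** The crossing point is a proper convex combination of p1 and p3, distinct because S is positive,
    so strict convexity leaves a gap a c |p1 - p3|^2. *)
Lemma sqnorm_x0 : sqnorm x0 < 1.
Proof.
pose D := (p1.1 - p3.1) ^+ 2 + (p1.2 - p3.2) ^+ 2.
have D0 : 0 < D.
  rewrite lt_neqAle addr_ge0 ?sqr_ge0 // andbT eq_sym paddr_eq0 ?sqr_ge0 //.
  apply/negP; rewrite !sqrf_eq0 => /andP[/eqP e1 /eqP e2].
  by move: S0; rewrite /S e1 e2 !mul0r subr0 ltxx.
have -> : sqnorm x0 = a * (a + c) * sqnorm p1 + c * (a + c) * sqnorm p3 - a * c * D.
  by rewrite /sqnorm /x0 /D /=; ring.
rewrite n1 n3 ac; have : 0 < a * c * D by rewrite !mulr_gt0.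
by move: ac; lra.
Qed.

(** [L z] is the convex combination of two corners and [x0] with weights |z.1|, |z.2| and the
    remainder, so convexity of [sqnorm] applies. *)
Lemma quad_map_sqnorm z : diamond z ->
  sqnorm (L z) <= 1 - (1 - `|z.1| - `|z.2|) * (1 - sqnorm x0).
Proof.
case: z => x y; rewrite /diamond /= => xy1.
have [q1 nq1 [e1 e2]] : exists2 q, sqnorm q = 1 &
    stretch a c x * (p1.1 - p3.1) = `|x| * (q.1 - x0.1) /\
    stretch a c x * (p1.2 - p3.2) = `|x| * (q.2 - x0.2).
  have cE : c = 1 - a by rewrite -ac; ring.
  rewrite /stretch /x0 cE; case: (ger0P x) => _.
    by exists p1 => //=; split; ring.
  by exists p3 => //=; split; ring.
have [q2 nq2 [e3 e4]] : exists2 q, sqnorm q = 1 &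
    stretch b d y * (p2.1 - p4.1) = `|y| * (q.1 - x0.1) /\
    stretch b d y * (p2.2 - p4.2) = `|y| * (q.2 - x0.2).
  have dE : d = 1 - b by rewrite -bd; ring.
  rewrite /stretch /x0 /= mid1 mid2 dE; case: (ger0P y) => _.
    by exists p2 => //=; split; ring.
  by exists p4 => //=; split; ring.
rewrite /L /quad_map /= e1 e2 e3 e4 -[a * p1.1 + _]/x0.1 -[a * p1.2 + _]/x0.2.
have := normr_ge0 x; have := normr_ge0 y.
move: `|x| `|y| xy1 => u v uv1 v0 u0; have w0 : 0 <= 1 - u - v by lra.
have uvw : u + v + (1 - u - v) = 1 by ring.
have k1 := sq_convex3 q1.1 q2.1 x0.1 u0 v0 w0 uvw.
have k2 := sq_convex3 q1.2 q2.2 x0.2 u0 v0 w0 uvw.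
have -> : sqnorm (x0.1 + u * (q1.1 - x0.1) + v * (q2.1 - x0.1),
     x0.2 + u * (q1.2 - x0.2) + v * (q2.2 - x0.2)) =
   (u * q1.1 + v * q2.1 + (1 - u - v) * x0.1) ^+ 2 +
   (u * q1.2 + v * q2.2 + (1 - u - v) * x0.2) ^+ 2.
  by rewrite /sqnorm /=; ring.
apply: (le_trans (lerD k1 k2)).
have -> : u * q1.1 ^+ 2 + v * q2.1 ^+ 2 + (1 - u - v) * x0.1 ^+ 2 +
  (u * q1.2 ^+ 2 + v * q2.2 ^+ 2 + (1 - u - v) * x0.2 ^+ 2) =
  u * sqnorm q1 + v * sqnorm q2 + (1 - u - v) * sqnorm x0.
  by rewrite /sqnorm; ring.
by rewrite nq1 nq2; lra.
Qed.

Lemma coord_circle p : sqnorm p = 1 -> `|p.1| <= 1 /\ `|p.2| <= 1.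
Proof.
rewrite /sqnorm -(real_normK (num_real p.1)) -(real_normK (num_real p.2)) => h.
have := normr_ge0 p.1; have := normr_ge0 p.2.
by split; nra.
Qed.

Lemma coord_diff p q : sqnorm p = 1 -> sqnorm q = 1 ->
  `|p.1 - q.1| <= 2 /\ `|p.2 - q.2| <= 2.
Proof.
move=> /coord_circle[h1 h2] /coord_circle[h3 h4].
by split; apply: (le_trans (ler_normB _ _)); lra.
Qed.

Lemma quad_map_sub z z' :
  let u := stretch a c z.1 - stretch a c z'.1 in
  let v := stretch b d z.2 - stretch b d z'.2 in
  L z - L z' = (u * (p1.1 - p3.1) + v * (p2.1 - p4.1),
                u * (p1.2 - p3.2) + v * (p2.2 - p4.2)).
Proof. by rewrite /L /quad_map /=; congr pair => /=; ring. Qed.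

Lemma quad_map_lipschitz z z' : `|L z - L z'| <= 4 * `|z - z'|.
Proof.
have [h1 h2] := norm_coord (z - z').
have /andP[_ ku] := stretch_sub z.1 z'.1 a0 c0 ac.
have /andP[_ kv] := stretch_sub z.2 z'.2 b0 d0 bd.
have {}ku := le_trans ku h1; have {}kv := le_trans kv h2.
have [m1 m2] := coord_diff n1 n3; have [m3 m4] := coord_diff n2 n4.
rewrite quad_map_sub prod_normE /= ge_max.
have aux u v x y : `|u| <= `|z - z'| -> `|v| <= `|z - z'| -> `|x| <= 2 ->
    `|y| <= 2 -> `|u * x + v * y| <= 4 * `|z - z'|.
  move=> hu hv hx hy; apply: (le_trans (ler_normD _ _)); rewrite !normrM.
  have := ler_pM (normr_ge0 _) (normr_ge0 _) hu hx.
  have := ler_pM (normr_ge0 _) (normr_ge0 _) hv hy.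
  by lra.
by rewrite !aux.
Qed.

Lemma quad_map_expand : exists2 m, 0 < m & forall z z',
  m * `|z - z'| <= `|L z - L z'|.
Proof.
pose m := Num.min (Num.min a c) (Num.min b d).
have m0 : 0 < m by rewrite !lt_min a0 b0 c0 d0.
exists (m * S / 4) => [|z z']; first by rewrite divr_gt0 // mulr_gt0.
have /andP[ku _] := stretch_sub z.1 z'.1 a0 c0 ac.
have /andP[kv _] := stretch_sub z.2 z'.2 b0 d0 bd.
have [m1 m2] := coord_diff n1 n3; have [m3 m4] := coord_diff n2 n4.
have := quad_map_sub z z'; have := norm_coord (L z - L z').
set u := stretch a c _ - _ in ku *; set v := stretch b d _ - _ in kv * => nD DE.
(* Cramer's rule recovers u and v from the image difference. The later factor 4 comes from two
   terms, each with a diagonal coordinate of size at most 2. *)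
have uS : u * S = (L z - L z').1 * (p2.2 - p4.2) - (L z - L z').2 * (p2.1 - p4.1).
  by rewrite DE /S /=; ring.
have vS : v * S = (L z - L z').2 * (p1.1 - p3.1) - (L z - L z').1 * (p1.2 - p3.2).
  by rewrite DE /S /=; ring.
move: nD uS vS; move: (L z - L z') => D [nD1 nD2] uS vS.
have aux w x y x' y' : w * S = x * x' - y * y' -> `|x| <= `|D| -> `|y| <= `|D| ->
    `|x'| <= 2 -> `|y'| <= 2 -> `|w| * S <= 4 * `|D|.
  move=> wS hx hy hx' hy'.
  rewrite -[S](ger0_norm (ltW S0)) -normrM wS.
  apply: (le_trans (ler_normB _ _)); rewrite !normrM.
  have := ler_pM (normr_ge0 _) (normr_ge0 _) hx hx'.
  have := ler_pM (normr_ge0 _) (normr_ge0 _) hy hy'.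
  by lra.
have {}uS := aux _ _ _ _ _ uS nD1 nD2 m4 m3.
have {}vS := aux _ _ _ _ _ vS nD2 nD1 m1 m2.
have aux2 x w n : m <= n -> n * x <= w -> 0 <= x -> w * S <= 4 * `|D| ->
    m * S / 4 * x <= `|D|.
  move=> mn nx x_ge0 wD.
  have h1 : m * x <= w by apply: le_trans nx; rewrite ler_wpM2r.
  have h2 : m * x * S <= w * S by rewrite ler_wpM2r // ltW.
  by have -> : m * S / 4 * x = m * x * S / 4; [ring | lra].
have mac : m <= Num.min a c by rewrite ge_min lexx.
have mbd : m <= Num.min b d by rewrite ge_min lexx orbT.
rewrite prod_normE /= maxEle; case: ifP => _.
  exact: aux2 mbd kv (normr_ge0 _) vS.
exact: aux2 mac ku (normr_ge0 _) uS.
Qed.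

End QuadMap.

(** The two-sided Lipschitz bounds transfer uniform continuity and separation from the disc to the
    diamond; the strict clause keeps the inner part of the chords off the circle, where the disc
    touches the graph. *)
Lemma inscribed_diamond t1 t2 t3 t4 :
  t1 < t2 -> t2 < t3 -> t3 < t4 -> t4 < t1 + 2 * pi ->
  exists L : R * R -> R * R,
  [/\ L (1, 0) = circle_pt t1 /\ L (-1, 0) = circle_pt t3,
      L (0, 1) = circle_pt t2 /\ L (0, -1) = circle_pt t4,
      forall z, diamond z -> unit_disc (L z) /\
        (`|z.1| + `|z.2| < 1 -> sqnorm (L z) < 1),
      forall z z', `|L z - L z'| <= 4 * `|z - z'| &
      exists2 m, 0 < m & forall z z', m * `|z - z'| <= `|L z - L z'|].
Proof.
move=> h12 h23 h34 h41.
have A0 : 0 < orient (circle_pt t2) (circle_pt t3) (circle_pt t4).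
  by apply: orient_circle => //; lra.
have B0 : 0 < orient (circle_pt t1) (circle_pt t3) (circle_pt t4).
  by apply: orient_circle => //; lra.
have C0 : 0 < orient (circle_pt t1) (circle_pt t2) (circle_pt t4).
  by apply: orient_circle => //; lra.
have D0 : 0 < orient (circle_pt t1) (circle_pt t2) (circle_pt t3).
  by apply: orient_circle => //; lra.
have circle1 t : sqnorm (circle_pt t) = 1 by rewrite /sqnorm /= cos2Dsin2.
have := (circle1 t1, circle1 t2, circle1 t3, circle1 t4).
move: (circle_pt t1) (circle_pt t2) (circle_pt t3) (circle_pt t4) A0 B0 C0 D0.
move=> p1 p2 p3 p4 A0 B0 C0 D0 [[[n1 n2] n3] n4].
pose S := (p1.1 - p3.1) * (p2.2 - p4.2) - (p1.2 - p3.2) * (p2.1 - p4.1).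
have SAC : S = orient p2 p3 p4 + orient p1 p2 p4 by rewrite /S /orient; ring.
have SBD : S = orient p1 p3 p4 + orient p1 p2 p3 by rewrite /S /orient; ring.
have S0 : 0 < S by rewrite SAC addr_gt0.
have Sn0 : S != 0 by rewrite gt_eqF.
(* S is twice the area of the quadrilateral, cut into two triangles by either diagonal; the ratios
   of these areas are the barycentric weights of the crossing point on the other diagonal. *)
pose a := orient p2 p3 p4 / S; pose c := orient p1 p2 p4 / S.
pose b := orient p1 p3 p4 / S; pose d := orient p1 p2 p3 / S.
have a0 : 0 < a by rewrite divr_gt0.
have b0 : 0 < b by rewrite divr_gt0.
have c0 : 0 < c by rewrite divr_gt0.
have d0 : 0 < d by rewrite divr_gt0.
have ac : a + c = 1 by rewrite /a /c -mulrDl -SAC divff.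
have bd : b + d = 1 by rewrite /b /d -mulrDl -SBD divff.
have mid1 : a * p1.1 + c * p3.1 = b * p2.1 + d * p4.1.
  by rewrite /a /b /c /d /orient; field.
have mid2 : a * p1.2 + c * p3.2 = b * p2.2 + d * p4.2.
  by rewrite /a /b /c /d /orient; field.
have [L1 L3 L2 L4] := quad_map_corners ac bd mid1 mid2.
exists (quad_map p1 p2 p3 p4 a c b d); split => // [z hz|z z'|].
- have := quad_map_sqnorm ac bd n1 n2 n3 n4 mid1 mid2 hz.
  have := sqnorm_x0 a0 c0 ac n1 n3 S0.
  move: hz; rewrite /unit_disc /diamond /= -/(sqnorm _) => hz h0 h.
  split; last by move=> h1; apply: (le_lt_trans h); nra.
  by apply: (le_trans h); nra.
- exact: quad_map_lipschitz.
- exact: quad_map_expand.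
Qed.

End Chords.

(** * Compactness *)

Section Compactness.
Variable R : realType.
Local Open Scope classical_set_scope.

(** Heine-Cantor for a map continuous on A only, from the near-covering form of compactness. *)
Lemma compact_unif_continuous (V W : normedModType R) (A : set V) (f : V -> W) :
  compact A -> {within A, continuous f} -> forall e : R, 0 < e ->
  exists2 d : R, 0 < d &
    forall x y, A x -> A y -> `|x - y| < d -> `|f x - f y| < e.
Proof.
move=> /compact_near_coveringP cA /subspace_continuousP cf e e0.
have e20 : 0 < e / 2 by rewrite divr_gt0.
pose P (d : R) x := forall y, A x -> A y -> `|x - y| < d -> `|f x - f y| < e.
have : \forall d \near (0 : R)^'+, A `<=` P d.
  apply: (cA _ _ P) => x Ax.
  have /cvgrPdist_lt/(_ _ e20) := cf x Ax.
  rewrite near_withinE => /nbhs_normP[r /= r0 hr].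
  have r20 : 0 < r / 2 by rewrite divr_gt0.
  exists (ball x (r / 2), [set d : R | d < r / 2]) => /=.
    split; first exact: nbhsx_ballx.
    exact: nbhs_right_lt.
  move=> [x' d] /= []; rewrite -ball_normE /ball_ /= => xx' dr y Ax' Ay x'y.
  rewrite [e]splitr -(subrK (f x) (f x')) -addrA.
  apply: (le_lt_trans (ler_normD _ _)); apply: ltrD.
    rewrite distrC; apply: hr => //=.
    by lra.
  apply: hr => //=; rewrite -(subrK x' x) -addrA.
  apply: (le_lt_trans (ler_normD _ _)).
  by lra.
move=> h; near (0 : R)^'+ => d; exists d => // x y Ax Ay xy.
by apply: (near h d) => //; near: d.
Unshelve. all: by end_near. Qed.

Lemma compact_bounded_away (T : topologicalType) (A : set T) (h : T -> R) :
  compact A -> {within A, continuous h} -> (forall x, A x -> 0 < h x) ->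
  exists2 e : R, 0 < e & forall x, A x -> e <= h x.
Proof.
move=> cA ch h0; have [->|/set0P A0] := eqVneq A set0.
  by exists 1.
have [c cc hc] := compact_EVT_min A0 cA ch.
exists (h c) => [|x Ax]; first by apply: h0; rewrite inE in cc.
by apply: hc; rewrite inE.
Qed.

Lemma within_continuous_dist (V V' W : normedModType R) (A : set V) (B : set V')
    (f : V -> W) (g : V' -> W) :
  {within A, continuous f} -> {within B, continuous g} ->
  {within A `*` B, continuous (fun z => `|f z.1 - g z.2| : R)}.
Proof.
move=> /subspace_continuousP cf /subspace_continuousP cg.
apply/subspace_continuousP => -[x y] /= [Ax By].
have cf' : f z.1 @[z --> within (A `*` B) (nbhs (x, y))] --> f x.
  apply: cvg_trans (cf x Ax) => U /= hU.
  exists ([set u | A u -> U (f u)], setT) => //=; first by split => //; exact: filterT.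
  by move=> [u v] /= [hu _] [Au _]; apply: hu.
have cg' : g z.2 @[z --> within (A `*` B) (nbhs (x, y))] --> g y.
  apply: cvg_trans (cg y By) => U /= hU.
  exists (setT, [set u | B u -> U (g u)]) => //=; first by split => //; exact: filterT.
  by move=> [u v] /= [_ hu] [_ Bv]; apply: hu.
by apply: cvg_norm; apply: cvgB.
Qed.

Lemma compact_separated (V V' W : normedModType R) (A : set V) (B : set V')
    (f : V -> W) (g : V' -> W) :
  compact A -> compact B ->
  {within A, continuous f} -> {within B, continuous g} ->
  (forall x y, A x -> B y -> f x <> g y) ->
  exists2 e : R, 0 < e & forall x y, A x -> B y -> e <= `|f x - g y|.
Proof.
move=> cA cB cf cg fg.
have [|e e0 he] := @compact_bounded_away _ (A `*` B) _ (compact_setX cA cB)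
  (within_continuous_dist cf cg).
  move=> [x y] [/= Ax By]; rewrite normr_gt0 subr_eq0; exact/eqP/fg.
by exists e => // x y Ax By; apply: (he (x, y)).
Qed.

(** Quantitative injectivity: the pairs at distance at least d form a compact set on which |f x - f
    y| is positive. *)
Lemma compact_expanding (V W : normedModType R) (A : set V) (f : V -> W) :
  compact A -> {within A, continuous f} ->
  (forall x y, A x -> A y -> f x = f y -> x = y) -> forall d : R, 0 < d ->
  exists2 e : R, 0 < e &
    forall x y, A x -> A y -> d <= `|x - y| -> e <= `|f x - f y|.
Proof.
move=> cA cf fI d d0.
pose B := (A `*` A) `&` [set z : V * V | d <= `|z.1 - z.2|].
have cB : compact B.
  apply: compact_closedI; first exact: compact_setX.
  have -> : [set z : V * V | d <= `|z.1 - z.2|] =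
      (fun z : V * V => `|z.1 - z.2|) @^-1` [set r | d <= r] by [].
  apply: (@preimage_closed _ _ _ [set r | d <= r]) (@closed_ge R d) => z _.
  apply: cvg_norm; apply: cvgB; [exact: cvg_fst|exact: cvg_snd].
have [||e e0 he] := @compact_bounded_away _ B (fun z => `|f z.1 - f z.2|) cB.
- have BA : B `<=` A `*` A by move=> z [].
  exact: continuous_subspaceW BA (within_continuous_dist cf cf).
- move=> [x y] [[/= Ax Ay] xy]; rewrite normr_gt0 subr_eq0.
  apply/eqP => /(fI _ _ Ax Ay) E.
  by move: xy; rewrite E subrr normr0 leNgt d0.
by exists e => // x y Ax Ay xy; apply: (he (x, y)).
Qed.

Lemma unif_continuous_within (V W : normedModType R) (A : set V) (f : V -> W) :
  (forall e : R, 0 < e -> exists2 d : R, 0 < d &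
    forall x y, A x -> A y -> `|x - y| < d -> `|f x - f y| < e) ->
  {within A, continuous f}.
Proof.
move=> h; apply/subspace_continuousP => x Ax; apply/cvgrPdist_lt => e e0.
have [d d0 hd] := h e e0; rewrite near_withinE; apply/nbhs_normP.
by exists d => //= y xy Ay; apply: hd.
Qed.

Lemma inv_nat_lt (c d : R) : 0 < c -> 0 < d ->
  exists2 N : nat, (0 < N)%N & c / N%:R < d.
Proof.
move=> c0 d0; exists (Num.truncn (c / d)).+1 => //.
by rewrite ltr_pdivrMr ?ltr0n // mulrC -ltr_pdivrMr // truncnS_gt.
Qed.

Lemma unit_disc_compact : compact (@unit_disc R).
Proof.
have sub : @unit_disc R `<=` `[-1, 1]%classic `*` `[-1, 1]%classic.
  by move=> [x y]; rewrite /unit_disc /= !in_itv /= => h; split; nra.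
apply: (subclosed_compact _ _ sub); last first.
  by apply: compact_setX; exact: segment_compact.
have -> : @unit_disc R = (fun z : R * R => z.1 * z.1 + z.2 * z.2) @^-1` [set r | r <= 1].
  by [].
apply: (@preimage_closed _ _ _ [set r : R | r <= 1]) (@closed_le R 1) => z _.
by apply: cvgD; apply: cvgM; by [exact: cvg_fst|exact: cvg_snd].
Qed.

End Compactness.

(** * Parts of a plane drawing *)

Section Chains.
Variable R : realType.
Implicit Types (X : set (R * R)) (e : R) (x y z : R * R).

(** Discrete substitute for a path inside X, in the form used by [crossing_chains]. *)
Definition chain X e x y : Prop := exists (n : nat) (f : nat -> R * R),
  [/\ f 0%N = x, f n = y, forall i, (i <= n)%N -> X (f i) &
      forall i, (i < n)%N -> `|f i - f i.+1| < e].

Lemma chain_refl X e x : X x -> chain X e x x.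
Proof. by move=> Xx; exists 0%N, (fun=> x). Qed.

Lemma chain_sym X e x y : chain X e x y -> chain X e y x.
Proof.
move=> [n [f [f0 fn fX ff]]]; exists n, (fun i => f (n - i)%N).
split; rewrite ?subn0 ?subnn // => i hi; first by apply: fX; rewrite leq_subr.
by rewrite distrC -(subnSK hi) ff // subnSK // leq_subr.
Qed.

Lemma chain_trans X e x y z : chain X e x y -> chain X e y z -> chain X e x z.
Proof.
move=> [n [f [f0 fn fX ff]]] [m [g [g0 gm gX gg]]].
exists (n + m)%N, (fun i => if (i <= n)%N then f i else g (i - n)%N); split=> //.
- case: leqP => h; last by rewrite addKn.
  have m0 : m = 0%N by lia.
  by rewrite m0 addn0 fn -g0 -[in RHS]gm m0.
- move=> i hi; case: leqP => h; first exact: fX.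
  by apply: gX; lia.
- move=> i hi; case: (leqP i n) => h; case: (leqP i.+1 n) => h'.
  + exact: ff.
  + have -> : i = n by lia.
    by rewrite subSnn fn -g0 gg //; lia.
  + lia.
  + by rewrite subSn ?gg //; lia.
Qed.

End Chains.

Section Noncrossing.
Variables (R : realType) (K : Type) (G : wgraph K) (D : plane_embedding R G).
Local Open Scope classical_set_scope.

Definition inner (C : {set vert G}) (x y : vert G) : bool :=
  [&& x \in C, y \in C & [exists e, ends e == [set x; y]%SET]].

Definition in_edge (C : {set vert G}) (e : edge G) : bool :=
  (source e \in C) && (target e \in C).

(** The drawing of the subgraph induced on C; the vertices are added separately because some may
    have no edge inside C. *)
Definition carrier (C : {set vert G}) : set (R * R) :=
  \bigcup_(e in [set e | in_edge C e]) (curve D e @` `[0, 1]) `|`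
  (pt D @` [set v | v \in C]).

Lemma finite_bigcup_compact (I : finType) (P : set I) (A : I -> set (R * R)) :
  (forall i, compact (A i)) -> compact (\bigcup_(i in P) A i).
Proof.
move=> cA; have -> : \bigcup_(i in P) A i =
    \big[setU/set0]_(i <- enum I | `[< P i >]) A i.
  rewrite big_mkcond -bigcup_seq eqEsubset; split=> x [i].
    by move=> Pi Ax; exists i; rewrite /= ?mem_enum // asboolT.
  by move=> _; case: asboolP => // Pi Ax; exists i.
by apply: bigsetU_compact.
Qed.

Lemma carrier_compact C : compact (carrier C).
Proof.
apply: compactU.
  apply: finite_bigcup_compact => e; apply: continuous_compact.
    exact: curve_continuous.
  exact: segment_compact.
rewrite -bigcup_imset1; apply: finite_bigcup_compact => v.
exact: compact_set1.
Qed.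

Lemma carrier_drawing C : carrier C `<=` drawing D.
Proof.
move=> x [[e _ [t ht <-]]|[v _ <-]]; last by left; exists v.
by right; exists e => //; exists t.
Qed.

(** Moves the ends of the arcs to the vertex case, so that each remaining case falls under one axiom
    of [plane_embedding]. *)
Lemma carrierP C (x : R * R) : carrier C x ->
  (exists2 v, v \in C & x = pt D v) \/
  (exists e t, [/\ in_edge C e, 0 < t < 1 & x = curve D e t]).
Proof.
move=> [[e /= /andP[Cs Ct] [t]]|[v /= Cv <-]]; last by left; exists v.
rewrite /= in_itv /= => /andP[]; rewrite le_eqVlt => /orP[/eqP<- _ <-|t0].
  by left; exists (source e); rewrite ?curve0.
rewrite le_eqVlt => /orP[/eqP-> <-|t1 <-].
  by left; exists (target e); rewrite ?curve1.
by right; exists e, t; rewrite /in_edge Cs Ct t0 t1.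
Qed.

Lemma carrier_disjoint (C C' : {set vert G}) (x : R * R) : [disjoint C & C']%B ->
  carrier C x -> carrier C' x -> False.
Proof.
move=> dis /carrierP[[v Cv ->]|[e [t [/andP[Cs Ct] t01 ->]]]] /carrierP[].
- by move=> [v' + /pt_inj E]; rewrite -E (disjointFr dis Cv).
- by move=> [e [t [_ t01 E]]]; apply: (curve_vert t01 (esym E)).
- by move=> [v Cv]; apply: curve_vert.
- move=> [f [u [/andP[Cs' Ct'] u01]]]; apply: curve_disj => //.
  by apply/eqP => E; rewrite E (disjointFl dis Cs') in Cs.
Qed.

Lemma carrier_edge C f (e : R) : 0 < e -> in_edge C f ->
  chain (carrier C) e (pt D (source f)) (pt D (target f)).
Proof.
move=> e0 Cf.
have [d d0 hd] := compact_unif_continuous (@segment_compact R 0 1)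
  (@curve_continuous _ _ _ D f) e0.
have [N N0 hN] := inv_nat_lt ltr01 d0.
have N0' : 0 < N%:R :> R by rewrite ltr0n.
have itv i : (i <= N)%N -> `[0, 1] (i%:R / N%:R : R).
  move=> iN; rewrite /= in_itv /= divr_ge0 //=.
  by rewrite ler_pdivrMr // mul1r ler_nat.
exists N, (fun i => curve D f (i%:R / N%:R)); split.
- by rewrite mul0r curve0.
- by rewrite divff ?gt_eqF // curve1.
- by move=> i iN; left; exists f => //; exists (i%:R / N%:R) => //; apply: itv.
- move=> i iN; apply: hd; [exact: itv (ltnW iN)|exact: itv|].
  have h : (i <= i.+1 <= i.+1)%N by rewrite leqnSn leqnn.
  by apply: (le_lt_trans (frac_near R N0 h)); rewrite -[X in X < _]mul1r.
Qed.

Lemma carrier_chain (C : {set vert G}) (e : R) (x y : vert G) : 0 < e -> x \in C -> connect (inner C) x y ->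
  chain (carrier C) e (pt D x) (pt D y).
Proof.
move=> e0 Cx /connectP[p + ->].
elim: p x Cx => [|z p IH] x Cx /=.
  by move=> _; apply: chain_refl; right; exists x.
case/andP => /and3P[_ Cz /existsP[f /eqP fE]] pp.
apply: chain_trans (IH z Cz pp).
have /setP/(_ (source f)) := fE; have /setP/(_ (target f)) := fE.
rewrite !in_set2 !eqxx orbT /= => /esym/orP ht /esym/orP hs.
have [hxz|hxz] : (source f = x /\ target f = z) \/ (source f = z /\ target f = x).
  have := loopless f.
  by move: hs ht => [] /eqP-> [] /eqP->; rewrite ?eqxx //; by [left|right].
  case: hxz => Es Et; rewrite -Es -Et; apply: carrier_edge => //.
  by rewrite /in_edge Es Et Cx Cz.
case: hxz => Es Et; rewrite -Es -Et; apply: chain_sym.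
by apply: carrier_edge => //; rewrite /in_edge Es Et Cx Cz.
Qed.

End Noncrossing.

(** * Disjoint connected parts do not interleave on a face *)

Section FaceNoncrossing.
Variables (R : realType) (K : Type) (G : wgraph K) (D : plane_embedding R G).
Local Open Scope classical_set_scope.

Lemma face_noncrossing (F : set (R * R)) (s : seq (vert G)) (v0 : vert G)
    (C C' : {set vert G}) (i1 i2 i3 i4 : nat) :
  face D F -> cyclic_on_face D F s -> [disjoint C & C']%B ->
  (i1 < i2)%N -> (i2 < i3)%N -> (i3 < i4)%N -> (i4 < size s)%N ->
  nth v0 s i1 \in C -> nth v0 s i3 \in C ->
  nth v0 s i2 \in C' -> nth v0 s i4 \in C' ->
  connect (inner C) (nth v0 s i1) (nth v0 s i3) ->
  connect (inner C') (nth v0 s i2) (nth v0 s i4) -> False.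
Proof.
move=> [x0 _ FE] [theta [phi [th cphi phiI phiV phiF]]] dis h12 h23 h34 h4.
have h3 : (i3 < size s)%N by apply: ltn_trans h4.
have h2 : (i2 < size s)%N by apply: ltn_trans h3.
have h1 : (i1 < size s)%N by apply: ltn_trans h2.
pose o1 := Ordinal h1; pose o2 := Ordinal h2.
pose o3 := Ordinal h3; pose o4 := Ordinal h4.
have vE (i : 'I_(size s)) : pt D (nth v0 s i) = phi (circle_pt (theta i)).
  by rewrite phiV (tnth_nth v0).
move=> C1 C3 C2 C4 con13 con24.
have /andP[t12 _] := th o1 o2 h12; have /andP[t23 _] := th o2 o3 h23.
have /andP[t34 _] := th o3 o4 h34.
have /andP[_ t41] := th o1 o4 (ltn_trans h12 (ltn_trans h23 h34)).
have [L [[L1 L3] [L2 L4] Ld Llip [m m0 Lexp]]] :=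
  inscribed_diamond t12 t23 t34 t41.
pose psi z := phi (L z).
have psi1 : psi (1, 0) = pt D (nth v0 s i1) by rewrite /psi L1 (vE o1).
have psi2 : psi (0, 1) = pt D (nth v0 s i2) by rewrite /psi L2 (vE o2).
have psi3 : psi (-1, 0) = pt D (nth v0 s i3) by rewrite /psi L3 (vE o3).
have psi4 : psi (0, -1) = pt D (nth v0 s i4) by rewrite /psi L4 (vE o4).
have FD : F `<=` ~` drawing D by rewrite FE; exact: connected_component_sub.
(* The disc meets the drawing only at points of the unit circle, and [L z] is strictly inside it. *)
have psi_in z : `|z.1| + `|z.2| < 1 -> ~ drawing D (psi z).
  move=> hz; have [Lz /(_ hz) Lz1] := Ld z (ltW hz).
  have [[i E]|/FD //] := phiF _ Lz.
  by move: Lz1; rewrite E /sqnorm /= cos2Dsin2 ltxx.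
have psi_unif (e : R) : 0 < e -> exists2 d : R, 0 < d & forall z z',
    diamond z -> diamond z' -> `|z - z'| < d -> `|psi z - psi z'| < e.
  move=> e0.
  have [d d0 hd] := compact_unif_continuous (@unit_disc_compact R) cphi e0.
  exists (d / 4) => [|z z' /Ld[Lz _] /Ld[Lz' _] zz']; first by rewrite divr_gt0.
  by apply: hd => //; apply: (le_lt_trans (Llip _ _)); lra.
have psi_axis (g : R -> R * R) : (forall t, `|t| <= 1 -> diamond (g t)) ->
    (forall t t', `|g t - g t'| = `|t - t'|) ->
    {within `[-1, 1], continuous (psi \o g)}.
  move=> gd gi; apply: unif_continuous_within => e e0.
  have [d d0 hd] := psi_unif e e0; exists d => // t t'.
  rewrite /= !in_itv /= -!ler_norml => ht ht' tt'.
  by apply: hd; rewrite ?gi //; exact: gd.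
have g1d (t : R) : `|t| <= 1 -> diamond (t, 0 : R).
  by move=> ht; have [] := diamond_axes ht.
have g2d (t : R) : `|t| <= 1 -> diamond (0 : R, t).
  by move=> ht; have [] := diamond_axes ht.
have cid (A : set (R * R)) : {within A, continuous (@id (R * R))}.
  by apply: continuous_subspaceT => x.
have c1 : {within `[-1, 1], continuous (psi \o (fun t => (t, 0)))}.
  apply: psi_axis => // t t'.
  by rewrite prod_normE /= subrr normr0; apply/max_idPl.
have c2 : {within `[-1, 1], continuous (psi \o (fun t => (0, t)))}.
  apply: psi_axis => // t t'.
  by rewrite prod_normE /= subrr normr0; apply/max_idPr.
(* A chord meets the drawing only at its two ends, which belong to the opposite carrier. *)
have out (C0 C0' : {set vert G}) (g : R -> R * R) : [disjoint C0 & C0']%B ->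
    (forall t, `|t| < 1 -> `|(g t).1| + `|(g t).2| < 1) ->
    carrier D C0' (psi (g 1)) -> carrier D C0' (psi (g (-1))) ->
    forall x t, carrier D C0 x -> `[-1, 1] t -> x <> (psi \o g) t.
  move=> d0 hg p1 pN1 x t Cx; rewrite /= in_itv /= => /andP[].
  rewrite le_eqVlt => /orP[/eqP<- _ E|tN1].
    by apply: carrier_disjoint d0 Cx _; rewrite E.
  rewrite le_eqVlt => /orP[/eqP-> E|t1 E].
    by apply: carrier_disjoint d0 Cx _; rewrite E.
  apply: (psi_in (g t)); first by apply: hg; rewrite ltr_norml tN1.
  by rewrite -E; apply: carrier_drawing Cx.
have vC (C0 : {set vert G}) v : v \in C0 -> carrier D C0 (pt D v) by move=> ?; right; exists v.
have itvc := @segment_compact R (-1) 1.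
have [e1 e10 far1] := compact_separated (@carrier_compact _ _ _ D C)
  (@carrier_compact _ _ _ D C') (cid _) (cid _)
  (fun x y Cx Cy E => carrier_disjoint dis Cx (eq_ind_r (carrier D C') Cy E)).
have [|e2 e20 far2] := compact_separated (@carrier_compact _ _ _ D C) itvc (cid _) c2.
  apply: (out _ C') => //; rewrite ?psi2 ?psi4; try exact: vC.
  by move=> t; rewrite /= normr0 add0r.
have [|e3 e30 far3] := compact_separated (@carrier_compact _ _ _ D C') itvc (cid _) c1.
  apply: (out _ C) => //; rewrite ?psi1 ?psi3; try exact: vC.
  by rewrite disjoint_sym.
  by move=> t; rewrite /= normr0 addr0.
have [e4 e40 far4] := compact_expanding (@unit_disc_compact R) cphi phiI m0.
(* One threshold below four separations: between the carriers, between each carrier and the chord of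
   the other, and between [phi]-images of disc points at distance at least m. *)
pose e := Num.min (Num.min e1 e2) (Num.min e3 e4).
have e0 : 0 < e by rewrite !lt_min e10 e20 e30.
have ee1 : e <= e1 by rewrite !ge_min lexx.
have ee2 : e <= e2 by rewrite !ge_min lexx !orbT.
have ee3 : e <= e3 by rewrite !ge_min lexx !orbT.
have ee4 : e <= e4 by rewrite !ge_min lexx !orbT.
have eh : 0 < e / 2 by rewrite divr_gt0.
have [d d0 hd] := psi_unif _ eh.
have [N N0 hN] := inv_nat_lt (ltr0n R 2) d0.
have [p [alpha [a0 ap aX aa]]] := carrier_chain D eh C1 con13.
have [q [beta [b0 bq bX bb]]] := carrier_chain D eh C2 con24.
apply: (@crossing_chains R psi e N e0 N0 _ _ alpha beta p q);
  rewrite ?psi1 ?psi2 ?psi3 ?psi4 //.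
- by move=> z z' dz dz' zz'; apply: hd => //; apply: le_lt_trans hN.
- move=> z z' /Ld[Lz _] /Ld[Lz' _] zz'; apply: (le_trans ee4).
  apply: far4 => //; apply: le_trans (Lexp _ _).
  by rewrite ler_pMr.
- by move=> i j ip jq; apply: (le_trans ee1); apply: far1; [exact: aX|exact: bX].
- move=> i t ip t1; apply: (le_trans ee2); apply: far2; first exact: aX.
  by rewrite /= in_itv /= -ler_norml.
- move=> j t jq t1; apply: (le_trans ee3); rewrite distrC.
  by apply: far3; [exact: bX | rewrite /= in_itv /= -ler_norml].
Qed.

End FaceNoncrossing.

(** * Superposition of two matchings *)

Section MatchingOff.
Import boot.fintype boot.finset.
Variables (K : Type) (G : wgraph K).
Implicit Types (S C : {set vert G}) (N : {set edge G}) (e f : edge G).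

(** A perfect matching of G - S, kept as a set of edges of G so that matchings of different
    deletions can be superposed. *)
Definition matching_off S N : bool :=
  [forall e in N, forall f in N, (e != f) ==> [disjoint ends e & ends f]]
  && [forall v, [exists e in N, v \in ends e] == (v \notin S)].

Lemma pairwise_disjointP N :
  reflect (forall e f v, e \in N -> f \in N -> v \in ends e -> v \in ends f ->
             e = f)
    [forall e in N, forall f in N, (e != f) ==> [disjoint ends e & ends f]].
Proof.
apply: (iffP 'forall_in_forall_inP) => [h e f v eN fN ve vf|h e eN f fN].
  apply/eqP; apply: contraT => ef.
  by have /implyP/(_ ef) := h e eN f fN; move=> /disjointFr/(_ ve); rewrite vf.
apply/implyP; apply: contraNT => /pred0Pn[v /andP[ve vf]].
by apply/eqP/(h e f v).
Qed.

Lemma matching_offP S N :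
  reflect ((forall e f v, e \in N -> f \in N -> v \in ends e -> v \in ends f ->
              e = f) /\
           (forall v, (exists2 e, e \in N & v \in ends e) <-> v \notin S))
    (matching_off S N).
Proof.
apply: (iffP andP) => -[/pairwise_disjointP h1 h2]; split=> //.
- by move=> v; rewrite -(eqP (forallP h2 v)); split=> /exists_inP.
- by apply/forallP => v; apply/eqP; apply/exists_inP/idP => /h2.
Qed.

Lemma matching_off_source S N e : matching_off S N -> e \in N ->
  (source e \notin S) && (target e \notin S).
Proof.
move=> /matching_offP[_ h] eN.
by apply/andP; split; apply/h; exists e; rewrite // !inE eqxx ?orbT.
Qed.

Definition other_end e v := if v == source e then target e else source e.

(** The default v makes this an involution on all vertices, whose fixed points are exactly the
    deleted ones. *)
Definition partner N v :=
  if [pick e in N | v \in ends e] is Some e then other_end e v else v.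

Lemma other_endE e v : v \in ends e -> ends e = [set v; other_end e v]%SET.
Proof.
by rewrite !inE /other_end; case: eqP => [->|_ /eqP->] //; rewrite /ends setUC.
Qed.

Lemma other_endK e v : v \in ends e -> other_end e (other_end e v) = v.
Proof.
rewrite !inE /other_end; have /negbTE ne := loopless e.
by case/orP => /eqP->; rewrite ?eqxx (eq_sym (target e)) ne ?eqxx.
Qed.

Lemma other_end_neq e v : v \in ends e -> other_end e v != v.
Proof.
rewrite !inE /other_end; have ne := loopless e.
by case/orP => /eqP->; rewrite ?eqxx (eq_sym (target e)) ?(negbTE ne).
Qed.

Section Partner.
Variables (S : {set vert G}) (N : {set edge G}).
Hypothesis NS : matching_off S N.

Lemma partner_edge e v : e \in N -> v \in ends e -> partner N v = other_end e v.
Proof.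
move=> eN ve; rewrite /partner; case: pickP => [f /andP[fN vf]|/(_ e)].
  by have [h _] := matching_offP _ _ NS; rewrite (h _ _ _ eN fN ve vf).
by rewrite eN ve.
Qed.

Lemma partner_out v : v \in S -> partner N v = v.
Proof.
move=> vS; rewrite /partner; case: pickP => // e /andP[eN ve].
have [_ /(_ v) h] := matching_offP _ _ NS.
by have : v \notin S; [apply/h; exists e | rewrite vS].
Qed.

Lemma partner_in v : v \notin S ->
  exists2 e, e \in N & v \in ends e /\ partner N v = other_end e v.
Proof.
have [_ /(_ v) h] := matching_offP _ _ NS.
by move=> /h[e eN ve]; exists e => //; rewrite (partner_edge eN ve).
Qed.

Lemma partnerK : involutive (partner N).
Proof.
move=> v; have [vS|/partner_in[e eN [ve ->]]] := boolP (v \in S).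
  by rewrite !partner_out.
rewrite (@partner_edge e) ?other_endK //.
by rewrite (other_endE ve) !inE eqxx orbT.
Qed.

Lemma partner_fix v : (partner N v == v) = (v \in S).
Proof.
have [vS|/partner_in[e eN [ve ->]]] := boolP (v \in S).
  by rewrite partner_out ?eqxx.
exact/negbTE/other_end_neq.
Qed.

End Partner.

Lemma involution_even (T : finType) (X : {set T}) (g : T -> T) :
  involutive g -> (forall x, x \in X -> g x \in X /\ g x != x) -> ~~ odd #|X|.
Proof.
move=> gK; elim: {X}#|X| {-2}X (leqnn #|X|) => [|n IH] X Xn Xg.
  by move: Xn; rewrite leqn0 => /eqP->.
have [->|[x xX]] := set_0Vmem X; first by rewrite cards0.
have [gxX gxx] := Xg x xX.
have E : #|X| = (#|X :\ x :\ g x|).+2.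
  by rewrite (cardsD1 x) xX (cardsD1 (g x) (X :\ x)) !inE gxx gxX.
rewrite E /= negbK; apply: IH => [|y]; first by move: Xn; rewrite E; lia.
rewrite !inE => /and3P[ygx yx yX]; have [gyX gyy] := Xg y yX.
split=> //; rewrite gyX andbT; apply/andP; split.
  by apply: contraNneq yx => /(inv_inj gK)->.
by apply: contraNneq ygx => <-; rewrite gK.
Qed.

Definition adj N : rel (vert G) :=
  fun x y => [exists e in N, ends e == [set x; y]%SET].

Definition comp N x : {set vert G} := [set y | connect (adj N) x y]%SET.

Definition adj_closed N C := forall x y, adj N x y -> x \in C -> y \in C.

Lemma adj_sym N : symmetric (adj N).
Proof. by move=> x y; rewrite /adj; under eq_existsb do rewrite setUC. Qed.

Lemma comp_refl N x : x \in comp N x.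
Proof. by rewrite inE connect0. Qed.

Lemma comp_closed N x : adj_closed N (comp N x).
Proof.
by move=> y z yz; rewrite !inE => /connect_trans; apply; apply: connect1.
Qed.

Lemma comp_min N x C : adj_closed N C -> x \in C -> comp N x \subset C.
Proof.
move=> cl xC; apply/subsetP => y; rewrite inE => /connectP[p + ->].
elim: p x xC => //= z p IH x xC /andP[xz]; apply: IH.
exact: cl xz xC.
Qed.

Lemma comp_connect N x y z : y \in comp N x -> z \in comp N x ->
  connect (inner (comp N x)) y z.
Proof.
have csym := sym_connect_sym (@adj_sym N).
move=> yC zC; have : connect (adj N) y z.
  by move: yC zC; rewrite !inE csym; apply: connect_trans.
move=> /connectP[p + zE]; rewrite {z zC}zE.
elim: p y yC => [|w p IH] y yC /=; first by rewrite connect0.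
case/andP => yw pp; have wC := comp_closed yw yC.
apply: connect_trans (IH w wC pp); apply: connect1.
rewrite /inner yC wC /=; have /exists_inP[e _ eE] := yw.
by apply/existsP; exists e.
Qed.

Lemma comp_disjoint N x y : y \notin comp N x ->
  [disjoint comp N x & comp N y].
Proof.
have csym := sym_connect_sym (@adj_sym N).
apply: contraR => /pred0Pn[z /andP[/=]]; rewrite !inE => xz yz.
by apply: connect_trans xz _; rewrite csym.
Qed.

Lemma adj_closedS N N' C : N \subset N' -> adj_closed N' C -> adj_closed N C.
Proof.
move=> /subsetP NN' cl x y /exists_inP[e /NN' eN' eE]; apply: cl.
by apply/exists_inP; exists e.
Qed.

Lemma closed_partner S N C v : matching_off S N -> adj_closed N C ->
  v \in C -> partner N v \in C.
Proof.
move=> NS cl vC; have [vS|vS] := boolP (v \in S).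
  by rewrite (partner_out NS vS).
have [e eN [ve ->]] := partner_in NS vS.
by apply: cl vC; apply/exists_inP; exists e => //; rewrite -other_endE.
Qed.

Lemma partner_closed S N C : matching_off S N ->
  (forall v, v \in C -> partner N v \in C) -> adj_closed N C.
Proof.
move=> NS cl x y /exists_inP[e eN /eqP eE] xC.
have xe : x \in ends e by rewrite eE !inE eqxx.
have := cl x xC; rewrite (partner_edge NS eN xe).
have /setP/(_ y) : [set x; other_end e x] = [set x; y] by rewrite -other_endE.
by rewrite !inE eqxx orbT => /orP[/eqP->|/eqP->].
Qed.

(** [partner N] is an involution without fixed points on the part of C outside S. *)
Lemma closed_parity S N C : matching_off S N -> adj_closed N C ->
  odd #|C :&: S| = odd #|C|.
Proof.
move=> NS cl; rewrite -(cardsID S C) oddD.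
suff /negbTE-> : ~~ odd #|C :\: S| by rewrite addbF.
apply: (involution_even (partnerK NS)) => x; rewrite !inE => /andP[xS xC].
rewrite (closed_partner NS cl) // andbT (partner_fix NS) xS; split=> //.
by rewrite -(partner_fix NS) (partnerK NS) eq_sym (partner_fix NS).
Qed.

Lemma matching_off_parity S N : matching_off S N -> odd #|S| = odd #|vert G|.
Proof.
move=> NS; rewrite -cardsT -(@closed_parity S N setT) ?setTI //.
Qed.

Section TwoMatchings.
Variables (S1 S2 : {set vert G}) (N1 N2 : {set edge G}).
Hypotheses (NS1 : matching_off S1 N1) (NS2 : matching_off S2 N2).
Hypothesis S12 : [disjoint S1 & S2].
Let N := N1 :|: N2.

(** By [closed_parity] for each matching, C meets S1 and S2 in sets whose sizes both have the parity
    of |C|. *)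
Lemma closed_marked_even C : adj_closed N C -> ~~ odd #|C :&: (S1 :|: S2)|.
Proof.
move=> cl; rewrite setIUr cardsU.
have -> : C :&: S1 :&: (C :&: S2) = set0.
  apply/eqP; rewrite -subset0; apply/subsetP => v.
  by rewrite !inE => /andP[/andP[_ v1] /andP[_ v2]]; rewrite (disjointFr S12 v1) in v2.
rewrite cards0 subn0 oddD (closed_parity NS1) ?(closed_parity NS2) ?addbb //.
  exact: adj_closedS (subsetUr _ _) cl.
exact: adj_closedS (subsetUl _ _) cl.
Qed.

(* With [f] the composite of the two partner involutions and [m] the length of
   the [f]-cycle of [x], the point [f^i x] is sent to [f^(-i) x] by one
   involution and to [f^(1-i) x] by the other; so the only other point of the
   cycle fixed by one of them is the one with [2 i = m] or [2 i = m + 1]. *)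
Lemma comp_marked_le2 x : x \in S1 ->
  exists y, comp N x :&: (S1 :|: S2) \subset [set x; y].
Proof.
move=> xS1; pose f v := partner N2 (partner N1 v).
have K1 := partnerK NS1; have K2 := partnerK NS2.
have finj : injective f by move=> u v /(inv_inj K2)/(inv_inj K1).
pose m := order f x.
have ret k : iter k f x = x -> (k < 2 * m)%N -> k = 0%N \/ k = m.
  have small l : iter l f x = x -> (l < m)%N -> l = 0%N.
    by move=> lx lm; rewrite -(findex_iter lm) lx findex0.
  move=> kx k2m; case: (ltnP k m) => km; first by left; apply: small.
  right; apply/eqP; rewrite eqn_leq km andbT -subn_eq0; apply/eqP/small.
    by move: kx; rewrite -{1}(subnK km) iterD iter_order.
  by lia.
have ff v : f (partner N1 (f v)) = partner N1 v by rewrite /f K1 K2.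
(* The involution of N1 conjugates f to its inverse and fixes x, which lies in S1. *)
have flip i : iter i f (partner N1 (iter i f x)) = x.
  elim: i => [|i IH] /=; first by rewrite (partner_out NS1).
  by rewrite -iterS iterSr ff.
exists (iter (uphalf m) f x); apply/subsetP => y; rewrite in_setI => /andP[yC yT].
have xo v : (v \in orbit f x) = fconnect f x v by rewrite fconnect_orbit.
(* The f-orbit of x is stable under both involutions, hence contains the whole component. *)
pose O : {set vert G} := [set v in orbit f x].
have f_O v : v \in O -> f v \in O.
  by rewrite !inE -!fconnect_orbit => /connect_trans; apply; apply: fconnect1.
have p1_O v : v \in O -> partner N1 v \in O.
  rewrite !inE -!fconnect_orbit => /iter_findex <-.
  have := fconnect_iter f (findex f x v) (partner N1 (iter (findex f x v) f x)).
  by rewrite flip fconnect_sym.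
have p2_O v : v \in O -> partner N2 v \in O.
  by move=> /p1_O/f_O; rewrite /f K1.
have clO : adj_closed N O.
  move=> u v /exists_inP[e]; rewrite in_setU => /orP[] eN eE.
    by apply: (partner_closed NS1 p1_O); apply/exists_inP; exists e.
  by apply: (partner_closed NS2 p2_O); apply/exists_inP; exists e.
have xO : x \in O by rewrite inE -fconnect_orbit connect0.
have := subsetP (comp_min clO xO) y yC; rewrite !inE -fconnect_orbit => xy.
have hi := findex_max xy; rewrite -/m in hi.
have yE := iter_findex xy; move: (findex f x y) hi yE => i im yE.
have := flip i; rewrite yE => fl.
move: yT; rewrite in_setU -(partner_fix NS1) -(partner_fix NS2).
case/orP => /eqP py.
  have /ret[|i0|i2] : iter (i + i) f x = x by rewrite iterD yE -{1}py.
  - by lia.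
  - have i00 : i = 0%N by lia.
    by rewrite -yE i00 eqxx.
  - by apply/orP; right; rewrite -yE; apply/eqP; congr iter; lia.
case: i im yE fl => [|i] im yE fl; first by rewrite -yE eqxx.
have fy : f (partner N1 y) = y by rewrite /f K1.
have /ret[|i0|i2] : iter (i.+1 + i) f x = x.
  apply: finj; rewrite -iterS -addnS iterD yE.
  by rewrite -[in LHS]fy -iterSr iterS fl.
- by lia.
- by lia.
- by have -> : uphalf m = i.+1; [lia | rewrite yE eqxx orbT].
Qed.

End TwoMatchings.

End MatchingOff.

(** * Swapping two matchings on a union of components *)

Section Swap.
Import boot.fintype boot.finset.
Variables (K : Type) (G : wgraph K).
Implicit Types (S C : {set vert G}) (N : {set edge G}).

(** The number of marked vertices is even, positive because of x, and at most two by
    [comp_marked_le2]. *)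
Lemma comp_marked_card S1 S2 N1 N2 x :
  matching_off S1 N1 -> matching_off S2 N2 -> [disjoint S1 & S2] ->
  x \in S1 :|: S2 -> #|comp (N1 :|: N2) x :&: (S1 :|: S2)| = 2.
Proof.
move=> NS1 NS2 S12 xS; set X := _ :&: _.
have even : ~~ odd #|X|.
  by apply: (closed_marked_even NS1 NS2 S12); apply: comp_closed.
have [y Xxy] : exists y, X \subset [set x; y].
  case/setUP: xS => xS; first exact: comp_marked_le2 xS.
  rewrite /X (setUC N1) (setUC S1).
  by apply: (comp_marked_le2 NS2 NS1) xS; rewrite disjoint_sym.
have xX : x \in X by rewrite in_setI comp_refl.
have X0 : (0 < #|X|)%N by apply/card_gt0P; exists x.
have := subset_leq_card Xxy; rewrite cards2.
by case: (#|X|) X0 even => [|[|[|n]]] //=; case: eqP.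
Qed.

(** Testing the source alone suffices: when C is closed for the superposition, both ends of each of
    its edges lie on the same side. *)
Definition swap C N N' : {set edge G} :=
  [set e | if source e \in C then e \in N' else e \in N].

Lemma swap_id C N N' : swap C (swap C N N') (swap C N' N) = N.
Proof. by apply/setP => e; rewrite !inE; case: (source e \in C). Qed.

Lemma swapU C N N' : swap C N N' :|: swap C N' N = N :|: N'.
Proof. by apply/setP => e; rewrite !inE; case: (source e \in C); rewrite // orbC. Qed.

Lemma swap_matching S S' C N N' :
  matching_off S N -> matching_off S' N' -> adj_closed (N :|: N') C ->
  matching_off [set v | if v \in C then v \in S' else v \in S] (swap C N N').
Proof.
move=> NS NS' cl.
have [dN cN] := matching_offP _ _ NS; have [dN' cN'] := matching_offP _ _ NS'.
have ends_C e v : e \in N :|: N' -> v \in ends e -> (source e \in C) = (v \in C).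
  move=> eN; rewrite !inE => /orP[]/eqP-> //; apply/idP/idP; apply: cl.
    by apply/exists_inP; exists e.
  by rewrite adj_sym; apply/exists_inP; exists e.
have swapN e v : e \in swap C N N' -> v \in ends e ->
    if v \in C then e \in N' else e \in N.
  move=> es ve; have eN : e \in N :|: N'.
    by move: es; rewrite !inE; case: ifP => _ ->; rewrite ?orbT.
  by move: es; rewrite inE (ends_C e v eN ve).
apply/matching_offP; split.
  move=> e f v es fs ve vf; have := swapN e v es ve; have := swapN f v fs vf.
  by case: ifP => _ fN eN; [apply: dN' fN ve vf | apply: dN fN ve vf].
move=> v; rewrite inE; split.
  case=> e es ve; have := swapN e v es ve.
  by case: ifP => _ eN; [apply/cN'|apply/cN]; exists e.
case: ifP => vC; [move/cN'|move/cN] => -[e eN ve]; exists e => //.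
  by rewrite inE (ends_C e v) // ?vC // inE eN orbT.
by rewrite inE (ends_C e v) // ?vC // inE eN.
Qed.

End Swap.

(** * Matching sums of deleted graphs *)

Section Sums.
Import boot.fintype boot.finset.
Variables (K : comNzRingType) (G : wgraph K).

(** Swapping preserves the total multiplicity of every edge in the pair. *)
Lemma swap_weight (C : {set vert G}) (N N' : {set edge G}) :
  (\prod_(e in swap C N N') weight e) * (\prod_(e in swap C N' N) weight e) =
  (\prod_(e in N) weight e) * (\prod_(e in N') weight e).
Proof.
rewrite big_mkcond [X in _ * X]big_mkcond -big_split /=.
rewrite [X in _ = X * _]big_mkcond [X in _ = _ * X]big_mkcond -big_split /=.
apply: eq_bigr => e _; rewrite !inE.
by case: (source e \in C); rewrite // mulrC.
Qed.

Lemma del_ends (S : {set vert G}) (e : del_edge S) (v : del_vert S) :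
  (v \in ends (e : edge (del S))) = (val v \in ends (val e)).
Proof. by rewrite !inE. Qed.

Lemma perfect_matching_del (S : {set vert G}) (N : {set edge (del S)}) :
  perfect_matching N = matching_off S (val @: N).
Proof.
apply/idP/idP.
  move=> /andP[/pairwise_disjointP h1 /forallP h2]; apply/matching_offP; split.
    move=> _ _ v /imsetP[e eN ->] /imsetP[f fN ->] ve vf; congr val.
    have vS : v \notin S.
      move: ve; rewrite !inE => /orP[]/eqP->; by have /andP[] := valP e.
    by apply: (h1 e f (Sub v vS)) => //; rewrite del_ends.
  move=> v; split=> [[_ /imsetP[e eN ->]]|vS].
    by rewrite !inE => /orP[]/eqP->; have /andP[] := valP e.
  have /exists_inP[e eN ve] := h2 (Sub v vS : vert (del S)).
  by exists (val e); [apply: imset_f | rewrite del_ends in ve].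
move=> /matching_offP[h1 h2]; apply/andP; split.
  apply/pairwise_disjointP => e f v eN fN; rewrite !del_ends => ve vf.
  by apply: val_inj; apply: (h1 _ _ (val v)) => //; apply: imset_f.
apply/forallP => v; have [_ /(_ (valP v))[_ /imsetP[e eN ->] ve]] := h2 (val v).
by apply/exists_inP; exists e => //; rewrite del_ends.
Qed.

Lemma M_del (S : {set vert G}) :
  M (del S) = \sum_(N | matching_off S N) \prod_(e in N) weight e.
Proof.
rewrite (reindex_onto (fun N : {set del_edge S} => val @: N)
  (fun N => [set e | val e \in N])) /=.
  apply: eq_big => [N|N _].
    rewrite perfect_matching_del; case: matching_off => //=; apply/esym/eqP.
    by apply/setP => e; rewrite inE mem_imset //; apply: val_inj.
  by rewrite big_imset //= => e f _ _; apply: val_inj.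
move=> N NS; apply/setP => e; apply/imsetP/idP => [[f]|eN].
  by rewrite inE => fN ->.
(* No edge of the matching meets S, so each one survives in the deletion. *)
have eS := matching_off_source NS eN.
by exists (Sub e eS); rewrite ?inE.
Qed.

Lemma M_del_mul (S S' : {set vert G}) :
  M (del S) * M (del S') =
  \sum_(p : {set edge G} * {set edge G} |
      matching_off S p.1 && matching_off S' p.2)
    (\prod_(e in p.1) weight e) * (\prod_(e in p.2) weight e).
Proof. by rewrite !M_del big_distrlr /= pair_big. Qed.

End Sums.

Section Interleave.
Variables (T : eqType) (k : nat) (a b : 'I_k -> T).

Lemma size_interleave : size (interleave a b) = (2 * k)%N.
Proof.
rewrite /interleave -[in RHS](size_enum_ord k).
by elim: (enum 'I_k) => //= i l ->; lia.
Qed.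

Lemma nth_interleave x0 (i : 'I_k) :
  nth x0 (interleave a b) (2 * i) = a i /\
  nth x0 (interleave a b) (2 * i).+1 = b i.
Proof.
suff h (l : seq 'I_k) n : (n < size l)%N ->
    nth x0 (flatten [seq [:: a i; b i] | i <- l]) (2 * n) = a (nth i l n) /\
    nth x0 (flatten [seq [:: a i; b i] | i <- l]) (2 * n).+1 = b (nth i l n).
  by have := h (enum 'I_k) i; rewrite size_enum_ord nth_ord_enum; apply.
elim: l n => [|j l IH] [|n] // nl.
by have -> : (2 * n.+1)%N = (2 * n).+2; [lia | apply: IH].
Qed.

Lemma mem_interleave x :
  (x \in interleave a b) = [exists i, x == a i] || [exists i, x == b i].
Proof.
apply/flatten_mapP/orP => [[i _]|].
  by rewrite !inE => /orP[]xi; [left|right]; apply/existsP; exists i.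
by case=> /existsP[i /eqP->]; exists i; rewrite ?mem_enum // !inE eqxx ?orbT.
Qed.

End Interleave.

(** * Parity of positions joined by a component *)

Section FaceParity.
Import boot.fintype boot.finset.
Variables (R : realType) (K : Type) (G : wgraph K) (D : plane_embedding R G).

(** Angles less than a full turn apart give distinct circle points, and [phi] is injective on the
    disc. *)
Lemma cyclic_uniq F s : cyclic_on_face D F s -> uniq s.
Proof.
case=> theta [phi [th _ phiI phiV _]].
case: s theta th phiV => [//|v0 s] theta th phiV.
set s' := v0 :: s in theta th phiV *.
have inj (i j : 'I_(size s')) : (i < j)%N -> nth v0 s' i <> nth v0 s' j.
  move=> ij E; have /andP[t1 t2] := th i j ij.
  have disc (t : R) : unit_disc (circle_pt t).
    by rewrite /unit_disc /= cos2Dsin2.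
  have [c s0] : circle_pt (theta i) = circle_pt (theta j).
    by apply: phiI => //; rewrite !phiV !(tnth_nth v0) /= E.
  pose u := (theta j - theta i) / 2.
  have su : 0 < sin u by apply: sin_gt0_pi; rewrite /u; lra.
  have : cos (theta j - theta i) = 1.
    by rewrite cosB c s0 -!expr2 cos2Dsin2.
  have -> : theta j - theta i = u + u by rewrite /u; lra.
  rewrite cosD -!expr2 => h; have := cos2Dsin2 u.
  by have : 0 < sin u ^+ 2; [exact: exprn_gt0 | lra].
apply/(uniqP v0) => i j; rewrite !inE => hi hj E; apply/eqP.
case: ltngtP => // ij; last by case: (inj (Ordinal hj) (Ordinal hi) ij).
by case: (inj (Ordinal hi) (Ordinal hj) ij).
Qed.

Lemma comp_odd_gap F s v0 (S1 S2 : {set vert G}) (N1 N2 : {set edge G}) p q :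
  face D F -> cyclic_on_face D F s ->
  matching_off S1 N1 -> matching_off S2 N2 -> [disjoint S1 & S2] ->
  S1 :|: S2 = [set x in s] -> (p < q < size s)%N ->
  nth v0 s q \in comp (N1 :|: N2) (nth v0 s p) -> odd (q - p).
Proof.
move=> hF hs NS1 NS2 S12 ST /andP[pq qs] qC; apply: contraT => even_pq.
have us := cyclic_uniq hs; have ps := ltn_trans pq qs.
set N := N1 :|: N2 in qC.
have mS i : (i < size s)%N -> nth v0 s i \in S1 :|: S2.
  by move=> hi; rewrite ST inE mem_nth.
have nth_eq i j : (i < size s)%N -> (j < size s)%N ->
    (nth v0 s i == nth v0 s j) = (i == j) by move=> hi hj; rewrite nth_uniq.
pose C := comp N (nth v0 s p).
(* The component already contains these two marked vertices and has room for no others. *)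
have CT : [set nth v0 s p; nth v0 s q] = C :&: (S1 :|: S2).
  apply/eqP; rewrite eqEcard (comp_marked_card NS1 NS2 S12 (mS _ ps)).
  rewrite cards2 nth_eq // neq_ltn pq andbT.
  apply/subsetP => x; rewrite in_set2 in_setI.
  by case/orP => /eqP->; rewrite mS // andbT // comp_refl.
have notC i : (i < size s)%N -> i != p -> i != q -> nth v0 s i \notin C.
  move=> hi ip iq; have /setP/(_ (nth v0 s i)) := CT.
  by rewrite in_set2 in_setI mS // andbT !nth_eq // (negbTE ip) (negbTE iq) => <-.
pose I := [set x in take (q - p.+1) (drop p.+1 s)].
have size_I : size (take (q - p.+1) (drop p.+1 s)) = (q - p.+1)%N.
  by rewrite size_take size_drop; case: ltnP => //; lia.
have odd_I : odd #|I|.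
  rewrite cardsE (card_uniqP _) ?size_I ?take_uniq ?drop_uniq //.
  by rewrite subnS; move: even_pq pq; rewrite -subn_gt0; case: (q - p)%N => //= n; rewrite negbK.
have inI i : (i < size s)%N -> (nth v0 s i \in I) = (p < i < q)%N.
  move=> hi; rewrite inE; apply/(nthP v0)/idP => [[l]|/andP[pi iq]].
    rewrite size_I => lq; rewrite nth_take // nth_drop => /eqP.
    by rewrite nth_eq //; [move/eqP=> <-; lia | lia].
  exists (i - p.+1)%N; first by rewrite size_I; lia.
  by rewrite nth_take ?nth_drop; [congr nth|]; lia.
(* The union of the components of the odd number of marked vertices strictly between p and q. It
   holds an even number of marked vertices, so one of them lies outside that interval. *)
pose J := [set v | [exists x in I, v \in comp N x]].
have J_even : ~~ odd #|J :&: (S1 :|: S2)|.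
  apply: (closed_marked_even NS1 NS2 S12) => u v uv.
  rewrite !inE => /exists_inP[x xI xu]; apply/exists_inP; exists x => //.
  exact: comp_closed uv xu.
have memP x : x \in S1 :|: S2 -> exists2 i, (i < size s)%N & x = nth v0 s i.
  by rewrite ST inE => xs; exists (index x s); rewrite ?index_mem ?nth_index.
have IT x : x \in I -> x \in S1 :|: S2.
  by rewrite ST !inE => /mem_take/mem_drop.
have : ~~ (J :&: (S1 :|: S2) \subset I).
  apply: contraNN J_even => sub; suff -> : J :&: (S1 :|: S2) = I by [].
  apply/eqP; rewrite eqEsubset sub; apply/subsetP => x xI.
  rewrite in_setI IT // andbT inE; apply/exists_inP; exists x => //.
  exact: comp_refl.
case/subsetPn => y; rewrite in_setI => /andP[yJ /memP[l ls yl]] yI.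
move: yJ yI; rewrite {y}yl inE => /exists_inP[x xI + yI].
have [r rs xr] := memP x (IT x xI); move: xI; rewrite {x}xr inI // => /andP[pr rq] lr.
have rC : nth v0 s r \notin C by apply: notC => //; lia.
have dis := comp_disjoint rC.
have lC : nth v0 s l \notin C by rewrite (disjointFl dis lr).
move: yI; rewrite inI // => plq.
have lp : l != p by apply: contraNneq lC => ->; rewrite comp_refl.
have lq : l != q by apply: contraNneq lC => ->.
have pC : nth v0 s p \in C by apply: comp_refl.
have rCr : nth v0 s r \in comp N (nth v0 s r) by apply: comp_refl.
have con13 := comp_connect pC qC; have con24 := comp_connect rCr lr.
(* Position r is between p and q and l is not, so the ends interleave in the order l, p, r, q or p,
   r, q, l. *)
have [lp'|ql] : (l < p)%N \/ (q < l)%N by clear -plq lp lq; lia.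
  have con42 := comp_connect lr rCr.
  by have := @face_noncrossing _ _ _ D F s v0 (comp N (nth v0 s r)) C
    l p r q hF hs; rewrite disjoint_sym => /(_ dis lp' pr rq qs lr rCr pC qC con42 con13).
by have := face_noncrossing hF hs dis pr rq ql ls pC qC rCr lr con13 con24.
Qed.

End FaceParity.

Section Main.
Import boot.fintype boot.finset.
Variables (R : realType) (K : Type) (G : wgraph K) (D : plane_embedding R G).
Variables (k : nat) (a b : 'I_k -> vert G) (F : set (R * R)).
Hypotheses (hF : face D F) (hab : cyclic_on_face D F (interleave a b)).
Let A : {set vert G} := [set a i | i : 'I_k].
Let B : {set vert G} := [set b i | i : 'I_k].

Lemma interleave_set : A :|: B = [set x in interleave a b].
Proof.
apply/setP => x; rewrite in_setU inE mem_interleave; congr (_ || _).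
  by apply/imsetP/existsP => -[i]; [move=> _ ->|move/eqP->]; exists i.
by apply/imsetP/existsP => -[i]; [move=> _ ->|move/eqP->]; exists i.
Qed.

Lemma interleave_disjoint : [disjoint A & B].
Proof.
apply/pred0P => x /=; apply/negP => /andP[/imsetP[i _ ->] /imsetP[i' _ E]].
have us := cyclic_uniq hab.
have [ai _] := nth_interleave a b (a i) i.
have [_ bi] := nth_interleave a b (a i) i'.
have /eqP := E; rewrite -{1}ai -bi nth_uniq ?size_interleave //.
- by move/eqP; lia.
- by have := ltn_ord i; lia.
- by have := ltn_ord i'; lia.
Qed.

(** The vertices of A occupy even positions of the list, so two of them in one component would
    contradict [comp_odd_gap]. *)
Lemma comp_single_marked S1 S2 (N1 N2 : {set edge G}) (j : 'I_k) :
  matching_off S1 N1 -> matching_off S2 N2 -> [disjoint S1 & S2] ->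
  S1 :|: S2 = A :|: B -> forall v, v \in comp (N1 :|: N2) (a j) ->
  (v \in A) = (v == a j).
Proof.
move=> NS1 NS2 S12 ST v vC; apply/imsetP/eqP => [[i _ vE]|->]; last by exists j.
rewrite interleave_set in ST.
have gap (l l' : 'I_k) : (l < l')%N -> a l' \notin comp (N1 :|: N2) (a l).
  move=> ll'; apply/negP => al'; have hl' := ltn_ord l'.
  have [al _] := nth_interleave a b (a j) l.
  have [al'' _] := nth_interleave a b (a j) l'.
  have := @comp_odd_gap _ _ _ D F _ (a j) S1 S2 N1 N2 (2 * l) (2 * l') hF hab
    NS1 NS2 S12 ST.
  rewrite size_interleave al al'' -mulnBr oddM => /(_ _ al') h.
  by have /h : (2 * l < 2 * l' < 2 * k)%N by lia.
rewrite vE; case: (ltngtP i j) => [ij|ji|/val_inj->//].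
  move: (gap _ _ ij); rewrite inE (sym_connect_sym (@adj_sym _ _ _)).
  by move: vC; rewrite vE inE => ->.
by move: (gap _ _ ji); rewrite -vE vC.
Qed.

End Main.

(** * The exchange involution *)

Section Exchange.
Import boot.fintype boot.finset.
Variables (R : realType) (K : comNzRingType) (G : wgraph K).
Variables (D : plane_embedding R G) (k : nat) (a b : 'I_k -> vert G).
Variables (F : set (R * R)) (j : 'I_k).
Hypotheses (hF : face D F) (hab : cyclic_on_face D F (interleave a b)).
Let A : {set vert G} := [set a i | i : 'I_k].
Let B : {set vert G} := [set b i | i : 'I_k].

Let state : Type := {set vert G} * ({set edge G} * {set edge G}).

Let component (t : state) := comp (t.2.1 :|: t.2.2) (a j).

(** One formula serves both directions: t.1 records only the B-part of the first deleted set, and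
    the move of a_j is implicit in the swap. *)
Definition exchange (t : state) : state :=
  let C := component t in
  ([set v | (v \in t.1) (+) ((v \in C) && (v \in B))],
   (swap C t.2.1 t.2.2, swap C t.2.2 t.2.1)).

(** Swapping preserves the union of the two matchings, hence the component used for the exchange. *)
Lemma exchangeK : involutive exchange.
Proof.
case=> Y [N1 N2]; rewrite /exchange /component /= swapU !swap_id.
by congr (_, _); apply/setP => v; rewrite !inE addbK.
Qed.

Let matched (S S' : {set vert G}) (p : {set edge G} * {set edge G}) :=
  matching_off S p.1 && matching_off S' p.2.

Let AB v : v \in A -> v \in B = false.
Proof. exact: disjointFr (interleave_disjoint hab). Qed.

Let jA : a j \in A. Proof. exact: imset_f. Qed.

Lemma exchange_state (S1 S2 : {set vert G}) (t : state) :
  [disjoint S1 & S2] -> S1 :|: S2 = A :|: B -> matched S1 S2 t.2 ->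
  let C := component t in
  [/\ matched [set v | if v \in C then v \in S2 else v \in S1]
              [set v | if v \in C then v \in S1 else v \in S2]
              (exchange t).2,
      a j \in C & forall v, v \in C -> (v \in A) = (v == a j)].
Proof.
move=> S12 ST /andP[NS1 NS2] /=; split.
- apply/andP; split; apply: swap_matching => //; first exact: comp_closed.
  by rewrite setUC; apply: comp_closed.
- exact: comp_refl.
- exact: comp_single_marked hF hab _ _ _ _ _ NS1 NS2 S12 ST.
Qed.

Lemma base_facts (Y : {set vert G}) v : Y \subset B ->
  [&& (v \in Y) ==> (v \in B), ~~ ((v \in A) && (v \in B)) &
      (v == a j) ==> (v \in A)].
Proof.
move=> /subsetP YB; apply/and3P; split.
- by apply/implyP; apply: YB.
- by apply/negP => /andP[/AB->].
- by apply/implyP => /eqP->.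
Qed.

(** Pointwise facts that reduce the set identities of the exchange to truth tables at a single
    vertex. *)
Lemma component_facts (C Y : {set vert G}) v : Y \subset B -> a j \in C ->
  (forall v, v \in C -> (v \in A) = (v == a j)) ->
  [&& (v \in Y) ==> (v \in B), ~~ ((v \in A) && (v \in B)),
      (v \in C) ==> ((v \in A) == (v == a j)) &
      (v == a j) ==> (v \in A) && (v \in C)].
Proof.
move=> YB jC CA; have /and3P[-> -> _] := base_facts v YB.
rewrite /=; apply/andP; split; first by apply/implyP => /CA->.
by apply/implyP => /eqP->; rewrite jA jC.
Qed.

Lemma exchange_odd (t : state) : t.1 \subset B ->
  matched (a j |: t.1) ((A :\ a j) :|: (B :\: t.1)) t.2 ->
  matched (exchange t).1 (A :|: (B :\: (exchange t).1)) (exchange t).2.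
Proof.
move=> YB m.
have [||m' jC CA] := exchange_state _ _ m.
- apply/pred0P => v; move: (base_facts v YB); rewrite /= !inE.
  by case: (v \in t.1) (v \in A) (v \in B) (v == a j) => [] [] [] [].
- apply/setP => v; move: (base_facts v YB); rewrite !inE.
  by case: (v \in t.1) (v \in A) (v \in B) (v == a j) => [] [] [] [].
have facts v := component_facts v YB jC CA.
congr (is_true (matched _ _ _)): m'; apply/setP => v.
- have := facts v; rewrite /exchange /= !inE; move: (connect _ _ v) => c.
  by case: (v \in t.1) (v \in A) (v \in B) c (v == a j) => [] [] [] [] [].
- have := facts v; rewrite /exchange /= !inE; move: (connect _ _ v) => c.
  by case: (v \in t.1) (v \in A) (v \in B) c (v == a j) => [] [] [] [] [].
Qed.

Lemma exchange_even (t : state) : t.1 \subset B ->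
  matched t.1 (A :|: (B :\: t.1)) t.2 ->
  matched (a j |: (exchange t).1) ((A :\ a j) :|: (B :\: (exchange t).1))
    (exchange t).2.
Proof.
move=> YB m.
have [||m' jC CA] := exchange_state _ _ m.
- apply/pred0P => v; move: (base_facts v YB); rewrite /= !inE.
  by case: (v \in t.1) (v \in A) (v \in B) (v == a j) => [] [] [] [].
- apply/setP => v; move: (base_facts v YB); rewrite !inE.
  by case: (v \in t.1) (v \in A) (v \in B) (v == a j) => [] [] [] [].
have facts v := component_facts v YB jC CA.
congr (is_true (matched _ _ _)): m'; apply/setP => v.
- have := facts v; rewrite /exchange /= !inE; move: (connect _ _ v) => c.
  by case: (v \in t.1) (v \in A) (v \in B) c (v == a j) => [] [] [] [] [].
- have := facts v; rewrite /exchange /= !inE; move: (connect _ _ v) => c.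
  by case: (v \in t.1) (v \in A) (v \in B) c (v == a j) => [] [] [] [] [].
Qed.

Lemma exchange_sub (t : state) : t.1 \subset B -> (exchange t).1 \subset B.
Proof.
move=> /subsetP YB; apply/subsetP => v; rewrite inE.
by have := YB v; case: (v \in t.1) => [->|_] //= /andP[].
Qed.

(** As |G| is even, the existence of a matching already forces the parity of Y or W. Both sums thus
    run over all states with B-part inside B, and [exchange] matches them with equal weights. *)
Lemma exchange_sum : ~~ odd #|vert G| ->
  \sum_(Y : {set vert G} | (Y \subset B) && odd #|Y|)
     M (del (a j |: Y)) * M (del ((A :\ a j) :|: (B :\: Y)))
  = \sum_(W : {set vert G} | (W \subset B) && ~~ odd #|W|)
     M (del W) * M (del (A :|: (B :\: W))).
Proof.
move=> evenG.
pose w (p : {set edge G} * {set edge G}) : K :=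
  (\prod_(e in p.1) weight e) * (\prod_(e in p.2) weight e).
transitivity (\sum_(t : state | (t.1 \subset B) &&
    matched (a j |: t.1) ((A :\ a j) :|: (B :\: t.1)) t.2) w t.2).
  under eq_bigr do rewrite M_del_mul.
  rewrite pair_big_dep /=; apply: eq_bigl => -[Y p] /=.
  rewrite -andbA; case: (boolP (Y \subset B)) => //= YB.
  apply/idP/idP => [/andP[]//|m]; rewrite -/(matched _ _ p) m andbT.
  have /andP[/matching_off_parity + _] := m.
  (* The deleted set is Y with a_j added; it has even size and a_j is not in B, so |Y| is odd. *)
  rewrite (negbTE evenG) cardsU1; case: (boolP (a j \in Y)) => [jY|_].
    by have := AB jA; rewrite (subsetP YB).
  by rewrite add1n /= => /negbFE.
transitivity (\sum_(t : state | (t.1 \subset B) &&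
    matched t.1 (A :|: (B :\: t.1)) t.2) w t.2); last first.
  under [RHS]eq_bigr do rewrite M_del_mul.
  rewrite pair_big_dep /=; apply: eq_bigl => -[Y p] /=.
  rewrite -andbA; case: (boolP (Y \subset B)) => //= YB.
  apply/idP/idP => [m|/andP[]//]; rewrite -/(matched _ _ p) m andbT.
  have /andP[/matching_off_parity-> _] := m; exact: evenG.
rewrite (reindex_inj (inv_inj exchangeK)); apply: eq_big => [t|t _].
  apply/andP/andP => -[YB m].
    by have := exchange_odd YB m; have := exchange_sub YB; rewrite exchangeK.
  by split; [apply: exchange_sub | apply: exchange_even].
exact: swap_weight.
Qed.

End Exchange.

Theorem theorem2p2 (R : realType) (K : comNzRingType) (G : wgraph K)
    (D : plane_embedding R G) (n k : nat)
    (hG : #|vert G| = (2 * n)%N) (hk : (2 <= k <= n)%N)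
    (F : set (R * R)) (hF : face D F) (a b : 'I_k -> vert G)
    (hab : cyclic_on_face D F (interleave a b)) (j : 'I_k) :
  let A : {set vert G} := [set a i | i : 'I_k]%SET in
  let B : {set vert G} := [set b i | i : 'I_k]%SET in
  \sum_(Y : {set vert G} | (Y \subset B) && odd #|Y|)
     M (del (a j |: Y)%SET) * M (del ((A :\ a j) :|: (B :\: Y))%SET)
  = \sum_(W : {set vert G} | (W \subset B) && ~~ odd #|W|)
     M (del W) * M (del (A :|: (B :\: W))%SET).
Proof.
by move=> A B; apply: (exchange_sum j hF hab); rewrite hG mul2n odd_double.
Qed.
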